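(* Let $K$ be a field, let $\Delta$ be a $(d,r)$-forest with $k$ facets, and let $\Delta^\vee$ be its Alexander dual. The nonzero Betti numbers of $K[\Delta^\vee]$ are $$b_0=b_{0,0}=1,\qquad b_1=b_{1,(k-1)(d-r)}=k,\qquad b_2=b_{2,k(d-r)}=k-1.$$ All $K[\Delta^\vee]$ are Cohen-Macaulay, and $K[\Delta^\vee]$ has a linear resolution if and only if $\Delta$ is a $(d,d-1)$-forest.
   Context: A simplex of dimension $d$ (a $d$-simplex) has $d+1$ vertices. Fat forests are defined recursively: a simplex $F_1$ of dimension $\ge 0$ is a fat forest; if $F_1,\dots,F_k$ are simplices and $G_{k-1}=F_1\cup\cdots\cup F_{k-1}$ is a fat forest, then $G_{k-1}\cup F_k$ is a fat forest if $G_{k-1}\cap F_k$ is a simplex of dimension $\ge -1$ (dimension $-1$ meaning that $G_{k-1}$ and $F_k$ are disjoint). A fat forest $F=F_1\cup\cdots\cup F_k$ is called a $(d,r)$-forest if $F_i$ is a $d$-simplex for $i=1,\dots,k$ and $(F_1\cup\cdots\cup F_{i-1})\cap F_i$ is an $r$-simplex for $i=2,\dots,k$. Facets are maximal faces. For a simplicial complex $\Delta$ on $[n]=\{1,\dots,n\}$, the Alexander dual is $\Delta^\vee=\{F : F^c\notin\Delta\}$, where $F^c=[n]\setminus F$. For a simplicial complex $\Gamma$ on $[n]$, the Stanley-Reisner ring is $K[\Gamma]=S/I$ with $S=K[x_1,\dots,x_n]$, where $I$ is generated by the squarefree monomials $x_{i_1}\cdots x_{i_m}$ for which $\{i_1,\dots,i_m\}$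 does not belong to $\Gamma$. The graded Betti numbers are $b_{i,j}=\dim_K\mathrm{Tor}^S_{i,j}(K[\Gamma],K)$, and $b_i=\sum_j b_{i,j}$. The ring $S/I$ has a linear resolution if, for some $t$, $I$ is generated by homogeneous elements of degree $t$ and all higher syzygies are linear, i.e. $\mathrm{Tor}^S_{i,j}(S/I,K)=0$ for $i\ge1$ and $j\ne i+t-1$.
   Formalization: The Betti numbers are claimed only for k ≥ 2: for k = 1, Δ is a simplex, its Alexander dual has no faces, K[Δ^∨] = 0 and b_0 = 0, so the stated formula fails; [n] is taken to be the vertex set of Δ. *)

(* Defs.v *)
From Stdlib Require Import ClassicalEpsilon.
From mathcomp Require Import all_boot all_order all_algebra.
From mathcomp Require Import mpoly.

Set Implicit Arguments.
Unset Strict Implicit.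
Unset Printing Implicit Defensive.

Import GRing.Theory.
Local Open Scope ring_scope.

(** * Simplicial complexes and fat forests *)

(* A simplicial complex on the vertex set [T] is the set of its faces, so that
   [set0] is the complex without faces and [[set set0]] is the simplex of
   dimension -1. *)
Section Complexes.
Variable T : finType.
Implicit Types (D F : {set {set T}}) (Fs : seq {set {set T}}).

(* Dimensions are integers, because -1 is allowed. *)
Definition is_simplex (e : int) F : Prop :=
  exists V : {set T}, #|V|%:Z = e + 1 /\ F = powerset V.

Definition union_complex Fs : {set {set T}} := \bigcup_(F <- Fs) F.

Inductive fat_forest : seq {set {set T}} -> Prop :=
| FatForest1 F (e : int) :
    0 <= e -> is_simplex e F -> fat_forest [:: F]
| FatForestS Fs F (e e' : int) :
    fat_forest Fs -> is_simplex e F ->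
    -1 <= e' -> is_simplex e' (union_complex Fs :&: F) ->
    fat_forest (rcons Fs F).

Definition is_forest (d r : int) D : Prop :=
  exists Fs : seq {set {set T}},
    [/\ fat_forest Fs,
        D = union_complex Fs,
        forall i, (i < size Fs)%N -> is_simplex d (nth set0 Fs i)
      & forall i, (0 < i < size Fs)%N ->
          is_simplex r (union_complex (take i Fs) :&: nth set0 Fs i)].

Definition facets D : {set {set T}} := [set F in D | maxset (mem D) F].

Definition alexander_dual D : {set {set T}} := [set F | ~: F \notin D].

End Complexes.

(** * Ideals of a commutative ring *)

Section Ideals.
Variable R : comNzRingType.
Implicit Types (I P G : R -> Prop).

Definition ideal_gen G : R -> Prop := fun p =>
  exists s : seq (R * R),
    (forall u, u \in s -> G u.2) /\ p = \sum_(u <- s) u.1 * u.2.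

Definition prime_ideal P : Prop :=
  [/\ [/\ P 0, forall x y, P x -> P y -> P (x + y)
        & forall x y, P y -> P (x * y)],
      ~ P 1
    & forall x y, P (x * y) -> P x \/ P y].

(* Prime ideals of [R/I] are given by the prime ideals of [R] containing [I]. *)
Definition prime_chain I (P : nat -> R -> Prop) (l : nat) : Prop :=
  (forall i, (i <= l)%N -> prime_ideal (P i) /\ (forall x, I x -> P i x)) /\
  (forall i, (i < l)%N -> (forall x, P i x -> P i.+1 x) /\
                          exists x, P i.+1 x /\ ~ P i x).

Definition krull_dim I (D : nat) : Prop :=
  (exists c, prime_chain I c D) /\ (forall c l, prime_chain I c l -> (l <= D)%N).

(* The ideal generated by [I] and the elements of [s]. *)
Definition ideal_add I (s : seq R) : R -> Prop :=
  ideal_gen (fun p => I p \/ p \in s).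

Definition regular_sequence I (s : seq R) : Prop :=
  (forall i, (i < size s)%N -> forall g,
     ideal_add I (take i s) (g * s`_i) -> ideal_add I (take i s) g) /\
  ~ ideal_add I s 1.

End Ideals.

(** * The polynomial ring S = K[x_1, ..., x_n] and quotients S/I *)

Section PolynomialRing.
Variables (K : fieldType) (n : nat).
Local Notation S := {mpoly K[n]}.
Implicit Types I : S -> Prop.

Definition SR_ideal (D : {set {set 'I_n}}) : S -> Prop :=
  ideal_gen (fun p => exists F : {set 'I_n}, F \notin D /\ p = \prod_(i in F) 'X_i).

Definition irrelevant_ideal : S -> Prop :=
  ideal_gen (fun p => exists i : 'I_n, p = 'X_i).

(* Depth of [S/I] with respect to its graded maximal ideal. *)
Definition depth I (D : nat) : Prop :=
  (exists s, [/\ regular_sequence I s, forall p, p \in s -> irrelevant_ideal p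
                & size s = D]) /\
  (forall s, regular_sequence I s -> (forall p, p \in s -> irrelevant_ideal p) ->
     (size s <= D)%N).

(* The zero ring is Cohen-Macaulay by convention. *)
Definition cohen_macaulay I : Prop :=
  (forall p, I p) \/ exists D, krull_dim I D /\ depth I D.

(** ** Graded free resolutions of S/I and Tor^S(S/I, K) *)

(* [gf_diff i] is the map F_(i+1) -> F_i, acting on row vectors from the right,
   where F_i is the direct sum of the S(- gf_deg i a).  [gf_aug] lifts the
   augmentation F_0 -> S/I to F_0 -> S. *)
Record graded_free := GradedFree {
  gf_rank : nat -> nat;
  gf_deg : forall i, 'I_(gf_rank i) -> int;
  gf_diff : forall i, 'M[S]_(gf_rank i.+1, gf_rank i);
  gf_aug : 'cV[S]_(gf_rank 0%N)
}.
Arguments gf_deg g {i} a.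

(* The zero polynomial is homogeneous of every degree, and the only one of
   negative degree. *)
Definition homogeneous (p : S) (e : int) : Prop :=
  forall m, m \in msupp p -> (mdeg m)%:Z = e.

Definition is_resolution I (C : graded_free) : Prop :=
  [/\ (forall i a b,
         homogeneous (gf_diff C i a b) (gf_deg C a - gf_deg C b)) /\
      (forall a, homogeneous (gf_aug C a ord0) (gf_deg C a)),
      forall p, exists v : 'rV_(gf_rank C 0), I (p - (v *m gf_aug C) ord0 ord0),
      forall v : 'rV_(gf_rank C 0),
        I ((v *m gf_aug C) ord0 ord0) <->
        exists w : 'rV_(gf_rank C 1), v = w *m gf_diff C 0
    & forall i (v : 'rV_(gf_rank C i.+1)),
        v *m gf_diff C i = 0 <->
        exists w : 'rV_(gf_rank C i.+2), v = w *m gf_diff C i.+1].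

(* The differential of F (x)_S K, where K = S/(x_1, ..., x_n). *)
Definition diffK (C : graded_free) i : 'M[K]_(gf_rank C i.+1, gf_rank C i) :=
  map_mx (mcoeff 0%MM) (gf_diff C i).

Definition cycles (C : graded_free) i : 'M[K]_(gf_rank C i) :=
  match i with
  | 0 => 1%:M
  | i'.+1 => kermx (diffK C i')
  end.

(* The row space of this matrix is the degree j part of F_i (x)_S K. *)
Definition degree_part (C : graded_free) i (j : int) : 'M[K]_(gf_rank C i) :=
  diag_mx (\row_a (gf_deg C a == j)%:R).

(* dim_K H_i(F (x)_S K)_j *)
Definition homology_dim (C : graded_free) (i : nat) (j : int) : nat :=
  (\rank (cycles C i :&: degree_part C i j)%MS
   - \rank (degree_part C i.+1 j *m diffK C i))%N.

Definition zero_graded_free : graded_free :=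
  @GradedFree (fun=> 0%N) (fun _ _ => 0) (fun=> 0) 0.

(* Tor is computed from a chosen graded free resolution with all F_i finitely
   generated.  One exists for every homogeneous ideal I, since S is Noetherian,
   and the dimensions do not depend on the choice. *)
Definition resolution I : graded_free :=
  epsilon (inhabits zero_graded_free) (is_resolution I).

(* b_{i,j} = dim_K Tor^S_{i,j}(S/I, K) *)
Definition betti I (i : nat) (j : int) : nat := homology_dim (resolution I) i j.

(* The sum of the b_{i,j} over all j: F_i (x)_S K, hence Tor_i, vanishes in every
   degree that is not the degree of a basis element of F_i. *)
Definition total_betti I (i : nat) : nat :=
  (\sum_(j <- undup [seq gf_deg (resolution I) a
                    | a : 'I_(gf_rank (resolution I) i)]) betti I i j)%N.

Definition linear_resolution I : Prop :=
  exists t : nat,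
    (exists G : S -> Prop, (forall g, G g -> g \is t.-homog) /\
                           (forall p, I p <-> ideal_gen G p)) /\
    (forall i (j : int), (1 <= i)%N -> j <> i%:Z + t%:Z - 1 -> betti I i j = 0%N).

End PolynomialRing.

Arguments SR_ideal K {n} D _.

(* Main.v *)
Require Import Defs.
From mathcomp Require Import all_boot all_order all_algebra.
From mathcomp Require Import mpoly.
From HB Require Import structures.
From Stdlib Require Import ClassicalEpsilon.
From mathcomp Require Import zify ring.

(* Write the forest as simplices on V_0, ..., V_(k-1), with W_l the vertex set of
   the intersection of V_l with its predecessors and p(l) < l such that W_l lies
   in V_p(l).  The ideal of the dual is generated by the monomials m_l of the
   complements of the V_l.  The variables of V_l \ W_l divide m_0, ..., m_(l-1) and
   are prime to m_l; hence, by induction on l, the relations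
   x^(V_l \ W_l) m_l = x^(V_p(l) \ W_l) m_p(l) freely generate all syzygies, and the
   resolution 0 -> S^(k-1) -> S^k -> S is exact and minimal.  The argument works for
   any family of pairwise coprime elements in place of the variables.  Substituting
   the curves x_0 + x_1^t for the variables x_t, t >= 2, one at a time keeps the
   family coprime, so the elements x_t - x_0 - x_1^t form a regular sequence of
   length n - 2 on S/I.  Both depth and dimension are at most n - 2: by counting
   monomials, any n - 1 elements are algebraically dependent modulo I, and such a
   dependence is impossible along a chain of ideals in which each element is
   regular modulo the ideal preceding the one it enters. *)

Set Implicit Arguments.
Unset Strict Implicit.
Unset Printing Implicit Defensive.

Import GRing.Theory.
Local Open Scope ring_scope.

(** * Ideals and homogeneous components *)

Definition ideal (R : comNzRingType) (J : R -> Prop) : Prop :=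
  [/\ J 0, forall x y, J x -> J y -> J (x + y) & forall x y, J y -> J (x * y)].

Section Ideals.
Variables (R : comNzRingType) (J : R -> Prop).
Hypothesis idJ : ideal J.

Lemma idealN x : J x -> J (- x).
Proof. by case: idJ => _ _ JM Jx; rewrite -mulN1r; apply: JM. Qed.

Lemma idealB x y : J x -> J y -> J (x - y).
Proof. by case: idJ => _ JD _ Jx Jy; apply: JD => //; apply: idealN. Qed.

Lemma idealBr x y : J (x - y) -> J x <-> J y.
Proof.
case: idJ => _ JD _ Jxy; split=> [Jx | Jy].
- by have := idealB Jx Jxy; rewrite opprB addrC subrK.
- by rewrite -[x](subrK y); apply: JD.
Qed.

Lemma ideal_sum (T : Type) (s : seq T) (P : pred T) (F : T -> R) :
  (forall i, P i -> J (F i)) -> J (\sum_(i <- s | P i) F i).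
Proof. by case: idJ => J0 JD _ JF; apply: big_ind. Qed.

Lemma ideal_sum_seq (T : eqType) (s : seq T) (F : T -> R) :
  (forall i, i \in s -> J (F i)) -> J (\sum_(i <- s) F i).
Proof.
move=> JF; rewrite big_seq; exact: ideal_sum.
Qed.

Lemma ideal_gen_sub (G : R -> Prop) :
  (forall g, G g -> J g) -> forall x, ideal_gen G x -> J x.
Proof.
move=> GJ x [s [Gs ->]]; apply: ideal_sum_seq => u us.
by case: idJ => _ _; apply; apply: GJ; apply: Gs.
Qed.

End Ideals.

Lemma ideal_genP (R : comNzRingType) (G : R -> Prop) : ideal (ideal_gen G).
Proof.
split.
- by exists [::]; split=> //; rewrite big_nil.
- move=> x y [s [Gs ->]] [t [Gt ->]]; exists (s ++ t); split; last by rewrite big_cat. 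
  move=> u; rewrite mem_cat => /orP []; [apply: Gs | apply: Gt].
- move=> x y [s [Gs ->]]; exists [seq (x * u.1, u.2) | u <- s]; split.
    by move=> u /mapP [v vs ->]; exact: (Gs v).
  by rewrite big_map mulr_sumr; apply: eq_bigr => u _; rewrite mulrA.
Qed.

Lemma ideal_gen_in (R : comNzRingType) (G : R -> Prop) x : G x -> ideal_gen G x.
Proof.
move=> Gx; exists [:: (1, x)]; split; first by move=> u; rewrite inE => /eqP ->.
by rewrite big_seq1 mul1r.
Qed.

Section Homogeneous.
Variables (K : fieldType) (n : nat).
Local Notation S := {mpoly K[n]}.

(** The degree is an integer so that twists such as [dr a - dc b] are allowed; in negative degrees
    the component is 0. *)
Definition hcomp (e : int) (p : S) : S :=
  \sum_(m <- msupp p | (mdeg m)%:Z == e) p@_m *: 'X_[m].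

Lemma mcoeff_hcomp e p m : (hcomp e p)@_m = if (mdeg m)%:Z == e then p@_m else 0.
Proof.
rewrite /hcomp linear_sum big_mkcond /=; case: (boolP (m \in msupp p)) => mp; last first.
  rewrite big1_seq ?(memN_msupp_eq0 mp) ?if_same // => m' /andP [_ m'p].
  rewrite mcoeffZ mcoeffX; case: (m' =P m) => [E|]; last by rewrite mulr0 if_same.
  by rewrite -E m'p in mp.
rewrite (bigD1_seq m) ?msupp_uniq //= mcoeffZ mcoeffX eqxx mulr1 big1 ?addr0 //.
by move=> m' /negbTE E; rewrite mcoeffZ mcoeffX E mulr0 if_same.
Qed.

Lemma hcompB e p q : hcomp e (p - q) = hcomp e p - hcomp e q.
Proof.
by apply/mpolyP=> m; rewrite mcoeffB !mcoeff_hcomp mcoeffB; case: ifP; rewrite ?subr0.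
Qed.

Lemma hcomp_sum (T : Type) e (s : seq T) (P : pred T) (F : T -> S) :
  hcomp e (\sum_(i <- s | P i) F i) = \sum_(i <- s | P i) hcomp e (F i).
Proof.
apply/mpolyP=> m; rewrite mcoeff_hcomp !linear_sum /=.
rewrite [RHS](eq_bigr _ (fun i _ => mcoeff_hcomp e (F i) m)).
by case: ifP => // _; rewrite big1.
Qed.

Lemma homogeneousP (p : S) (e : int) :
  homogeneous p e <-> (forall m, p@_m != 0 -> (mdeg m)%:Z = e).
Proof. by split=> H m; move: (H m); rewrite mcoeff_msupp. Qed.

Lemma homogeneous_hcomp e p : homogeneous (hcomp e p) e.
Proof. by apply/homogeneousP => m; rewrite mcoeff_hcomp; case: ifP => [/eqP // | _]; rewrite eqxx. Qed.

Lemma hcomp_homogeneous e e' p : homogeneous p e' -> hcomp e p = if e' == e then p else 0.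
Proof.
move/homogeneousP=> hp; apply/mpolyP=> m; rewrite mcoeff_hcomp.
have [pm|pm] := eqVneq p@_m 0.
  by rewrite pm if_same; case: (e' == e); rewrite ?pm ?mcoeff0.
by rewrite (hp _ pm); case: ifP => // _; rewrite mcoeff0.
Qed.

Lemma homogeneous0 e : homogeneous (0 : S) e.
Proof. by move=> m; rewrite msupp0. Qed.

Lemma homogeneousB (p q : S) e :
  homogeneous p e -> homogeneous q e -> homogeneous (p - q) e.
Proof. by move=> hp hq m /msuppB_le; rewrite mem_cat => /orP [/hp | /hq]. Qed.

Lemma homogeneousM (p q : S) e e' :
  homogeneous p e -> homogeneous q e' -> homogeneous (p * q) (e + e').
Proof.
move=> hp hq m /msuppM_le /allpairsP [[m1 m2] /= [/hp <- /hq <- ->]].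
by rewrite mdegD PoszD.
Qed.

Lemma homogeneous_sum (T : Type) e (s : seq T) (P : pred T) (F : T -> S) :
  (forall i, P i -> homogeneous (F i) e) -> homogeneous (\sum_(i <- s | P i) F i) e.
Proof.
move=> hF; apply: (big_ind (fun p => homogeneous p e)) => //; first exact: homogeneous0.
by move=> p q hp hq m /msuppD_le; rewrite mem_cat => /orP [/hp | /hq].
Qed.

Lemma homogeneousZX c (m : 'X_{1..n}) : homogeneous (c *: 'X_[m] : S) (mdeg m).
Proof.
apply/homogeneousP => m'; rewrite mcoeffZ mcoeffX; case: (m =P m') => [-> //|].
by rewrite mulr0 eqxx.
Qed.

Lemma homogeneous1 : homogeneous (1 : S) 0.
Proof. by have := @homogeneousZX 1 0%MM; rewrite scale1r mpolyX0 mdeg0. Qed.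

Lemma hcompM e e' p q : homogeneous q e' -> hcomp (e + e') (p * q) = hcomp e p * q.
Proof.
move=> hq; rewrite {1}[p]mpolyE mulr_suml hcomp_sum mulr_suml [RHS]big_mkcond.
apply: eq_bigr => m _; rewrite (@hcomp_homogeneous _ ((mdeg m)%:Z + e')).
  by rewrite (inj_eq (addIr e')).
exact: homogeneousM (@homogeneousZX _ _) hq.
Qed.

Definition homogeneous_mx (r c : nat) (dr : 'I_r -> int) (dc : 'I_c -> int)
  (M : 'M[S]_(r, c)) : Prop := forall a b, homogeneous (M a b) (dr a - dc b).

Lemma homogeneous_mxM r c t (dr : 'I_r -> int) (dc : 'I_c -> int) (dt : 'I_t -> int)
    (M : 'M[S]_(r, c)) (N : 'M[S]_(c, t)) :
  homogeneous_mx dr dc M -> homogeneous_mx dc dt N -> homogeneous_mx dr dt (M *m N).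
Proof.
move=> hM hN a b; rewrite mxE; apply: homogeneous_sum => i _.
rewrite -[dr a](subrK (dc i)) -addrA; exact: homogeneousM.
Qed.

Lemma homogeneous_mxB r c (dr : 'I_r -> int) (dc : 'I_c -> int) (M N : 'M[S]_(r, c)) :
  homogeneous_mx dr dc M -> homogeneous_mx dr dc N -> homogeneous_mx dr dc (M - N).
Proof. by move=> hM hN a b; rewrite !mxE; apply: homogeneousB. Qed.

Lemma homogeneous_mx1 r (dr : 'I_r -> int) : homogeneous_mx dr dr 1%:M.
Proof.
move=> a b; rewrite mxE; case: eqP => [->|_]; last exact: homogeneous0.
rewrite subrr; exact: homogeneous1.
Qed.

(** Arbitrary coefficients of the rows can be replaced by their components of the required degrees:
    since [M] and [A] are homogeneous, the factorization survives. *)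
Lemma homogeneous_rowsP r c t (dr : 'I_r -> int) (dc : 'I_c -> int) (dt : 'I_t -> int)
    (M : 'M[S]_(r, c)) (A : 'M[S]_(t, c)) :
  homogeneous_mx dr dc M -> homogeneous_mx dt dc A ->
  (forall a, exists w : 'rV_t, row a M = w *m A) ->
  exists X : 'M_(r, t), homogeneous_mx dr dt X /\ M = X *m A.
Proof.
move=> hM hA /fin_all_exists [w Ew].
exists (\matrix_(a, i) hcomp (dr a - dt i) (w a ord0 i)); split.
  by move=> a i; rewrite mxE; apply: homogeneous_hcomp.
apply/matrixP=> a b; rewrite mxE.
have := congr1 (fun M : 'rV_c => hcomp (dr a - dc b) (M ord0 b)) (Ew a).
rewrite !mxE (@hcomp_homogeneous _ (dr a - dc b)) // eqxx => ->.
rewrite hcomp_sum; apply: eq_bigr => i _; rewrite mxE.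
by rewrite -[dr a](subrK (dt i)) -addrA hcompM // addrK.
Qed.

End Homogeneous.

(** * Comparison of graded free resolutions *)

(** Chain maps and homotopies are built one degree at a time, in types that vary with the degree;
    the invariant [Q] carries what makes the next step solvable. *)
Lemma dependent_choice (T : nat -> Type) (Q : forall i, T i -> Prop)
    (R : forall i, T i -> T i.+1 -> Prop) (x0 : T 0%N) :
  Q 0%N x0 -> (forall i x, Q i x -> exists y, R i x y /\ Q i.+1 y) ->
  exists f : forall i, T i,
    f 0%N = x0 /\ forall i, Q i (f i) /\ R i (f i) (f i.+1).
Proof.
move=> Q0 step.
pose next i (s : {x : T i | Q i x}) :=
  constructive_indefinite_description _ (step i (proj1_sig s) (proj2_sig s)).
pose fix F i : {x : T i | Q i x} :=
  if i is i'.+1 then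
    exist _ (proj1_sig (next i' (F i'))) (proj2 (proj2_sig (next i' (F i'))))
  else exist _ x0 Q0.
exists (fun i => proj1_sig (F i)); split=> // i; split; first exact: proj2_sig (F i).
exact: (proj1 (proj2_sig (next i (F i)))).
Qed.

Section Comparison.
Variables (K : fieldType) (n : nat) (I : {mpoly K[n]} -> Prop).
Hypothesis idI : ideal I.
Hypothesis homI : forall p e, I p -> I (hcomp e p).
Local Notation S := {mpoly K[n]}.
Local Notation deg C i := (@gf_deg K n C i).

(** The augmentations need to agree only modulo [I], since [gf_aug] takes values in [S] instead of
    [S/I]. *)
Definition chain_map C C' (f : forall i, 'M[S]_(gf_rank C i, gf_rank C' i)) : Prop :=
  [/\ forall i, homogeneous_mx (deg C i) (deg C' i) (f i),
      forall a, I ((gf_aug C - f 0%N *m gf_aug C') a ord0)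
    & forall i, gf_diff C i *m f i = f i.+1 *m gf_diff C' i].

Lemma resolution_homogeneous_diff C i :
  is_resolution I C -> homogeneous_mx (deg C i.+1) (deg C i) (gf_diff C i).
Proof. by case=> [[hd _] _ _ _]. Qed.

Lemma resolution_diff_diff C i :
  is_resolution I C -> gf_diff C i.+1 *m gf_diff C i = 0.
Proof.
case=> _ _ _ ex; apply/row_matrixP => a; rewrite row_mul row0.
by apply/ex; exists (delta_mx ord0 a); rewrite rowE.
Qed.

Lemma ideal_mx_mul r t (w : 'rV[S]_r) (M : 'cV[S]_r) :
  (forall a, I (M a ord0)) -> I ((w *m M) ord0 t).
Proof.
by move=> IM; rewrite mxE; apply: ideal_sum => // i _; rewrite (ord1 t); case: idI => _ _; apply.
Qed.

(** The comparison theorem: the identity of [S/I] lifts to degree 0 because the augmentation of [C']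
    is onto modulo [I], and then upwards because [C'] is exact. *)
Lemma chain_map_exists C C' :
  is_resolution I C -> is_resolution I C' -> exists f, @chain_map C C' f.
Proof.
move=> resC resC'.
have [[hd ha] _ ex0 ex] := resC; have [[hd' ha'] su' ex0' ex'] := resC'.
have [f0 [hf0 If0]] : exists f0 : 'M[S]_(gf_rank C 0, gf_rank C' 0),
    homogeneous_mx (deg C 0%N) (deg C' 0%N) f0 /\
    forall a, I ((gf_aug C - f0 *m gf_aug C') a ord0).
  have /fin_all_exists [w Iw] := fun a => su' (gf_aug C a ord0).
  exists (\matrix_(a, b) hcomp (deg C 0%N a - deg C' 0%N b) (w a ord0 b)); split.
    by move=> a b; rewrite mxE; apply: homogeneous_hcomp.
  move=> a; have := homI (deg C 0%N a) (Iw a).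
  rewrite hcompB (@hcomp_homogeneous _ _ _ (deg C 0%N a)) // eqxx !mxE hcomp_sum.
  congr (I (_ - _)); apply: eq_bigr => b _; rewrite mxE.
  by rewrite -(hcompM _ _ (ha' b)) subrK.
(* The second clause says that [x] sends boundaries of [C] to boundaries of [C'], which is what the
   next lift needs. *)
pose Q i (x : 'M[S]_(gf_rank C i, gf_rank C' i)) :=
  homogeneous_mx (deg C i) (deg C' i) x /\
  forall w : 'rV_(gf_rank C i.+1), exists w', w *m gf_diff C i *m x = w' *m gf_diff C' i.
pose R i x y := gf_diff C i *m x = y *m gf_diff C' i :> 'M[S]_(_, gf_rank C' i).
have Q0 : Q 0%N f0.
  split=> // w; apply/ex0'.
  have : I ((w *m gf_diff C 0 *m gf_aug C) ord0 ord0) by apply/ex0; exists w.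
  apply: iffLR; apply: idealBr => //.
  have -> : forall M N : 'M[S]_1, M ord0 ord0 - N ord0 ord0 = (M - N) ord0 ord0.
    by move=> M N; rewrite !mxE.
  rewrite -!mulmxA -!mulmxBr mulmxA; exact: ideal_mx_mul.
have step i x : Q i x -> exists y, R i x y /\ Q i.+1 y.
  case=> hx ox.
  have hdx := homogeneous_mxM (resolution_homogeneous_diff resC) hx.
  have [|y [hy Ey]] := homogeneous_rowsP hdx (resolution_homogeneous_diff resC').
    by move=> a; have [w' Ew'] := ox (delta_mx ord0 a); exists w'; rewrite rowE mulmxA.
  exists y; split=> //; split=> // w; apply/ex'.
  by rewrite -mulmxA -Ey mulmxA -[_ *m gf_diff C i]mulmxA resolution_diff_diff // mulmx0 mul0mx.
have [f [f00 Hf]] := dependent_choice Q0 step.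
exists f; split; first by move=> i; case: (Hf i) => [[]].
- by rewrite f00.
- by move=> i; case: (Hf i).
Qed.

Lemma chain_map_id C : chain_map (fun i => 1%:M : 'M_(gf_rank C i)).
Proof.
split=> [i|a|i]; first exact: homogeneous_mx1.
- by rewrite mul1mx subrr mxE; case: idI.
- by rewrite mulmx1 mul1mx.
Qed.

Lemma chain_map_comp C C' C'' f g :
  @chain_map C C' f -> @chain_map C' C'' g -> chain_map (fun i => f i *m g i).
Proof.
case=> hf If df [hg Ig dg]; split=> [i|a|i].
- exact: homogeneous_mxM.
- have -> : gf_aug C - f 0%N *m g 0%N *m gf_aug C'' = (gf_aug C - f 0%N *m gf_aug C')
      + f 0%N *m (gf_aug C' - g 0%N *m gf_aug C'').
    by rewrite mulmxBr mulmxA addrA subrK.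
  rewrite mxE; case: (idI) => _ ID IM; apply: ID => //.
  by rewrite mxE; apply: ideal_sum => // i _; apply: IM.
- by rewrite mulmxA df -!mulmxA dg.
Qed.

(** The difference of two lifts of the identity of [S/I] lifts zero, and exactness of [C] produces
    the maps [h i] successively. *)
Lemma chain_homotopy C f g : is_resolution I C -> @chain_map C C f -> @chain_map C C g ->
  exists h : forall i, 'M[S]_(gf_rank C i, gf_rank C i.+1),
    [/\ forall i, homogeneous_mx (deg C i) (deg C i.+1) (h i),
        f 0%N - g 0%N = h 0%N *m gf_diff C 0
      & forall i, f i.+1 - g i.+1 = gf_diff C i *m h i + h i.+1 *m gf_diff C i.+1].
Proof.
move=> resC [hf If df] [hg Ig dg]; have [_ _ ex0 ex] := resC.
have hd i : homogeneous_mx (deg C i.+1) (deg C i) (gf_diff C i).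
  exact: resolution_homogeneous_diff.
pose phi i := f i - g i.
have hphi i : homogeneous_mx (deg C i) (deg C i) (phi i) by apply: homogeneous_mxB.
have dphi i : gf_diff C i *m phi i = phi i.+1 *m gf_diff C i.
  by rewrite mulmxBr mulmxBl df dg.
have [|h0 [hh0 Eh0]] := homogeneous_rowsP (hphi 0%N) (hd 0%N).
  move=> a; apply/ex0; rewrite -row_mul mxE mulmxBl.
  have := idealB idI (Ig a) (If a); congr I; rewrite !mxE.
  by rewrite opprB [LHS]addrC addrA subrK.
(* The second clause makes the rows of [phi i.+1 - gf_diff C i *m x] cycles, hence boundaries; the
   next homotopy writes them as such. *)
pose Q i (x : 'M[S]_(gf_rank C i, gf_rank C i.+1)) :=
  homogeneous_mx (deg C i) (deg C i.+1) x /\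
  (phi i.+1 - gf_diff C i *m x) *m gf_diff C i = 0.
pose R i x y := phi i.+1 = gf_diff C i *m x + y *m gf_diff C i.+1 :> 'M[S]_(gf_rank C i.+1).
have Q0 : Q 0%N h0 by split=> //; rewrite mulmxBl -dphi Eh0 mulmxA subrr.
have step i x : Q i x -> exists y, R i x y /\ Q i.+1 y.
  case=> hx Ex.
  have hr : homogeneous_mx (deg C i.+1) (deg C i.+1) (phi i.+1 - gf_diff C i *m x).
    by apply: homogeneous_mxB => //; apply: homogeneous_mxM hx.
  have [|y [hy Ey]] := homogeneous_rowsP hr (hd i.+1).
    by move=> a; apply/ex; rewrite -row_mul Ex row0.
  exists y; split; first by rewrite /R -Ey addrC subrK.
  split=> //; rewrite mulmxBl -dphi -mulmxA -Ey -mulmxBr subKr mulmxA.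
  by rewrite resolution_diff_diff // mul0mx.
have [h [h00 Hh]] := dependent_choice Q0 step.
exists h; split; first by move=> i; case: (Hh i) => [[]].
- by rewrite h00.
- by move=> i; case: (Hh i).
Qed.

End Comparison.

(** Rank-nullity for [Z] mapped by [f] into [Z'/B']: the kernel has rank at most that of [B], and
    the image lies in a space of dimension [\rank Z' - \rank B']. *)
Lemma leq_subquotient_rank (F : fieldType) r r' s s'
    (Z : 'M[F]_r) (B : 'M_(s, r)) (Z' : 'M[F]_r') (B' : 'M_(s', r')) (f : 'M_(r, r')) :
  (Z *m f <= Z')%MS -> (B' <= Z')%MS ->
  (forall u : 'rV_r, (u <= Z)%MS -> (u *m f <= B')%MS -> (u <= B)%MS) ->
  (\rank Z - \rank B <= \rank Z' - \rank B')%N.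
Proof.
move=> ZfZ' B'Z' inj.
have kerB' : (kermx (cokermx B') :=: B')%MS.
  apply/eqmxP/andP; split; first by rewrite submxE; apply/eqP/sub_kermxP.
  by apply/sub_kermxP/eqP; rewrite -submxE.
have lower : (\rank (Z :&: kermx (f *m cokermx B')) <= \rank B)%N.
  apply/mxrankS/row_subP => a; apply: inj.
    exact: submx_trans (row_sub _ _) (capmxSl _ _).
  rewrite submxE -mulmxA; apply/eqP/sub_kermxP.
  exact: submx_trans (row_sub _ _) (capmxSr _ _).
have upper : (\rank (Z *m (f *m cokermx B')) <= \rank Z' - \rank B')%N.
  have /mxrankS : (Z *m f *m cokermx B' <= Z' *m cokermx B')%MS by apply: submxMr.
  rewrite mulmxA => /leq_trans; apply.
  rewrite -(mxrank_mul_ker Z' (cokermx B')) (cap_eqmx (eqmx_refl Z') kerB').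
  by rewrite (capmx_idPr B'Z') addnK.
by rewrite -(mxrank_mul_ker Z (f *m cokermx B')); lia.
Qed.

(** * Independence of Tor of the chosen resolution *)

Section Homology.
Variables (K : fieldType) (n : nat) (I : {mpoly K[n]} -> Prop).
Hypothesis idI : ideal I.
Hypothesis homI : forall p e, I p -> I (hcomp e p).
Local Notation S := {mpoly K[n]}.
Local Notation deg C i := (@gf_deg K n C i).
Local Notation toK := (map_mx (mcoeff (0%MM : 'X_{1..n}))).

(** A nonzero constant term forces the degree [dr a - dc b] of the entry to be 0, so reduction to
    [K] respects the grading. *)
Lemma homogeneous_mx_diag r c (dr : 'I_r -> int) (dc : 'I_c -> int) (M : 'M[S]_(r, c)) (j : int) :
  homogeneous_mx dr dc M ->
  diag_mx (\row_a (dr a == j)%:R) *m toK M = toK M *m diag_mx (\row_b (dc b == j)%:R).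
Proof.
move=> hM; apply/matrixP=> a b; rewrite mul_diag_mx mul_mx_diag !mxE mulrC.
have [-> | M0] := eqVneq (M a b)@_0%MM 0; first by rewrite !mul0r.
have /eqP := (homogeneousP _ _).1 (hM a b) _ M0.
by rewrite mdeg0 eq_sym subr_eq0 => /eqP ->.
Qed.

Lemma degree_part_comm (C C' : graded_free K n) i i' (M : 'M[S]_(gf_rank C i, gf_rank C' i')) j :
  homogeneous_mx (deg C i) (deg C' i') M ->
  degree_part C i j *m toK M = toK M *m degree_part C' i' j.
Proof. exact: homogeneous_mx_diag. Qed.

Lemma sub_degree_part (C : graded_free K n) i j (u : 'rV[K]_(gf_rank C i)) :
  (u <= degree_part C i j)%MS -> u *m degree_part C i j = u.
Proof.
case/submxP=> w ->; rewrite -mulmxA; congr (_ *m _).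
apply/matrixP => a b; rewrite mul_diag_mx !mxE; case: (gf_deg a == j).
  by rewrite mul1r.
by rewrite mul0r mul0rn.
Qed.

Lemma cycles_chain_map C C' f i (u : 'rV[K]_(gf_rank C i)) : chain_map I f ->
  (u <= cycles C i)%MS -> (u *m toK (f i) <= cycles C' i)%MS.
Proof.
case=> _ _ df; case: i u => [|i] u /=; first by move=> _; apply: submx1.
move/sub_kermxP=> ud; apply/sub_kermxP.
by rewrite -mulmxA -map_mxM -df map_mxM mulmxA ud mul0mx.
Qed.

(** A chain map to [C'] followed by one back to [C] is homotopic to the identity, so the first is
    injective on homology. *)
Lemma homology_dim_le C C' i j : is_resolution I C -> is_resolution I C' ->
  (homology_dim C i j <= homology_dim C' i j)%N.
Proof.
move=> resC resC'.
have [f cf] := chain_map_exists idI homI resC resC'.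
have [g cg] := chain_map_exists idI homI resC' resC.
have [h [hh Eh0 EhS]] := chain_homotopy idI resC (chain_map_comp idI cf cg) (chain_map_id idI C).
have [hf _ df] := cf; have [hg _ dg] := cg.
have hd k := @resolution_homogeneous_diff _ _ I C k resC.
have hd' k := @resolution_homogeneous_diff _ _ I C' k resC'.
have toKd (D : graded_free K n) k : diffK D k = toK (gf_diff D k) by [].
apply: (@leq_subquotient_rank _ _ _ _ _ _ _ _ _ (toK (f i))).
- apply/row_subP=> a; rewrite row_mul sub_capmx.
  have : (row a (cycles C i :&: degree_part C i j)%MS
            <= cycles C i :&: degree_part C i j)%MS by apply: row_sub.
  rewrite sub_capmx => /andP [uZ uD]; rewrite cycles_chain_map //=.
  by rewrite -(sub_degree_part uD) -mulmxA degree_part_comm // mulmxA submxMl.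
- rewrite sub_capmx; apply/andP; split; last first.
    by rewrite toKd degree_part_comm // submxMl.
  case: i => [|i]; first exact: submx1.
  apply/sub_kermxP; rewrite !toKd -mulmxA -map_mxM.
  by rewrite (resolution_diff_diff _ resC') map_mx0 mulmx0.
- move=> u; rewrite sub_capmx => /andP [uZ uD] /submxP [w Ew].
  (* The first term is a boundary because [u *m toK (f i)] is one in [C'], the second by the
     homotopy. *)
  have E : u = u *m toK (f i) *m toK (g i) - u *m toK (f i *m g i - 1%:M).
    by rewrite map_mxB map_mxM map_mx1 mulmxBr mulmx1 mulmxA subKr.
  rewrite E; apply: addmx_sub.
    rewrite Ew -!mulmxA toKd -map_mxM dg map_mxM.
    rewrite [_ *m (toK (g i.+1) *m _)]mulmxA degree_part_comm // -!mulmxA.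
    by rewrite !mulmxA -[X in (X <= _)%MS]mulmxA submxMl.
  rewrite eqmx_opp.
  suff -> : u *m toK (f i *m g i - 1%:M) = u *m toK (h i) *m toK (gf_diff C i).
    rewrite -(sub_degree_part uD) -[u *m _ *m _]mulmxA.
    by rewrite (degree_part_comm _ (hh i)) mulmxA -mulmxA submxMl.
  (* In degree 0 the homotopy has a single term; above, the term starting with the differential
     vanishes on the cycle [u]. *)
  case: i u uZ {uD w Ew E} => [|i] u uZ; first by rewrite Eh0 map_mxM mulmxA.
  rewrite EhS map_mxD !map_mxM mulmxDr !mulmxA.
  by rewrite (sub_kermxP uZ : u *m toK (gf_diff C i) = 0) !mul0mx add0r.
Qed.

(** Since [C] is a resolution, the [epsilon] in [resolution] does return one, and the previous
    inequality applies in both directions. *)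
Lemma betti_resolution C i j : is_resolution I C -> betti I i j = homology_dim C i j.
Proof.
move=> resC.
have resR : is_resolution I (resolution I) by apply: epsilon_spec; exists C.
by apply/eqP; rewrite eqn_leq !homology_dim_le.
Qed.

End Homology.

(** * Syzygies of a tree of simplices *)

Section TreeSyzygies.
Variables (T : finType) (k : nat) (V W : nat -> {set T}) (par : nat -> nat).

(** This is the running intersection property of a clique tree with edges from [i] to [par i]: [W i]
    is the intersection of [V i] with the union of all its predecessors. *)
Definition tree_decomposition : Prop :=
  forall i, (0 < i < k)%N ->
    [/\ (par i < i)%N, W i \subset V i, W i \subset V (par i)
      & forall j, (j < i)%N -> V j :&: V i \subset W i].

Variables (R : idomainType) (y : T -> R).

Definition setprod (A : {set T}) : R := \prod_(c in A) y c.

(** The coefficient at generator [i] of the syzygy attached to the edge from [j] to [par j]. Natural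
    number indices allow induction on the number of generators. *)
Definition relation (j i : nat) : R :=
  (i == j)%:R * setprod (V j :\: W j) - (i == par j)%:R * setprod (V (par j) :\: W j).

(** Coprimality is expressed as [y c'] being a nonzerodivisor modulo [y c], a form that calls for no
    unique factorization. *)
Definition pairwise_coprime : Prop :=
  (forall c, y c != 0) /\
  forall c c' q t, c != c' -> q * y c' = y c * t -> exists t', q = y c * t'.

Hypothesis treeV : tree_decomposition.
Hypothesis cop : pairwise_coprime.

Lemma setprod_neq0 A : setprod A != 0.
Proof. by apply/prodf_neq0 => c _; apply: cop.1. Qed.

Lemma setprodU (A B : {set T}) : [disjoint A & B] -> setprod (A :|: B) = setprod A * setprod B.
Proof. by move=> dAB; rewrite /setprod -bigU //; apply: eq_bigl => c; rewrite !inE. Qed.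

Lemma setprod_coprime1 c (s : seq T) q t : c \notin s ->
  q * \prod_(b <- s) y b = y c * t -> exists t', q = y c * t'.
Proof.
elim: s t => [|b s IHs] t; first by rewrite big_nil mulr1 => _ ->; exists t.
rewrite inE negb_or big_cons mulrCA mulrC => /andP [cb cs] E.
by have [t' E'] := cop.2 _ _ _ _ cb E; apply: IHs E'.
Qed.

Lemma setprod_coprime (A B : {set T}) q t : [disjoint A & B] ->
  q * setprod B = setprod A * t -> exists t', q = setprod A * t'.
Proof.
rewrite /setprod -!big_enum -(eq_disjoint (mem_enum A)) -(eq_disjoint_r (mem_enum B)) /=.
elim: (enum A) q t => [|c s IHs] q t; first by rewrite big_nil => _ _; exists q; rewrite mul1r.
rewrite disjoint_cons big_cons => /andP [cB dsB]; rewrite -mulrA => E.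
have [q' Eq] := setprod_coprime1 cB E.
have [|t' Et] := IHs q' t dsB.
  by apply: (mulfI (cop.1 c)); rewrite -E Eq mulrA.
by exists t'; rewrite Eq Et mulrA.
Qed.

(** The two terms of the relation, times their generators, both equal the product over the
    complement of [W j]. *)
Lemma relation_setprod j : (0 < j < k)%N ->
  forall l, (j < l)%N -> \sum_(i < l) relation j i * setprod (~: V i) = 0.
Proof.
move=> jk l jl; have [pj Wj Wp _] := treeV jk.
under eq_bigr do rewrite mulrBl -!mulrA.
have pick a (F : nat -> R) : (a < l)%N -> \sum_(i < l) (nat_of_ord i == a)%:R * F i = F a.
  move=> al; rewrite (bigD1 (Ordinal al)) //= eqxx mul1r big1 ?addr0 // => i ia.
  by rewrite -(inj_eq val_inj) in ia; rewrite (negbTE ia) mul0r.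
rewrite sumrB.
rewrite (pick j (fun i => setprod (V j :\: W j) * setprod (~: V i))) //.
rewrite (pick (par j) (fun i => setprod (V (par j) :\: W j) * setprod (~: V i))); last first.
  exact: ltn_trans jl.
have compl a : W j \subset V a -> setprod (V a :\: W j) * setprod (~: V a) = setprod (~: W j).
  move=> Wa; rewrite -setprodU; last first.
    by rewrite disjoints_subset setCK subsetDl.
  congr setprod; apply/setP=> c; rewrite !inE.
  by case: (boolP (c \in W j)) => [/(subsetP Wa) ->|] //=; rewrite orbN.
by rewrite !compl // subrr.
Qed.

(** As [par j < j], the matrix of relations is triangular, with nonzero diagonal; elimination of
    syzygies and freeness of the relations both rest on this. *)
Lemma relation_top j i : (0 < j < k)%N -> (j < i)%N -> relation j i = 0.
Proof.
move=> jk ji; have [pj _ _ _] := treeV jk.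
by rewrite /relation !gtn_eqF ?mul0r ?subr0 //; apply: ltn_trans ji.
Qed.

Lemma relation_diag j : (0 < j < k)%N -> relation j j = setprod (V j :\: W j).
Proof.
move=> jk; have [pj _ _ _] := treeV jk.
by rewrite /relation eqxx mul1r gtn_eqF // mul0r subr0.
Qed.

(* The variables in [V l :\: W l] divide every earlier generator but not the one
   of [l], so they divide the coefficient of [l]; subtracting a multiple of the
   relation of [l] removes that coefficient. *)
Lemma syzygy_relations l (v : nat -> R) : (l <= k)%N ->
  \sum_(i < l) v i * setprod (~: V i) = 0 ->
  exists w, forall i, (i < l)%N -> v i = \sum_(1 <= j < l) w j * relation j i.
Proof.
elim: l v => [|l IHl] v lk; first by exists (fun=> 0).
case: l IHl lk => [|l] IHl lk.
  rewrite big_ord1 => /eqP; rewrite mulf_eq0 (negbTE (setprod_neq0 _)) orbF => /eqP v0.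
  by exists (fun=> 0) => i; rewrite ltnS leqn0 => /eqP ->; rewrite big_geq.
set m := l.+1 in IHl lk * => E.
have mk : (0 < m < k)%N by [].
have [pm Wm Wp Vm] := treeV mk.
have [q Eq] : exists q, v m = setprod (V m :\: W m) * q.
  have dvd i : (i < m)%N -> setprod (~: V i) =
      setprod (V m :\: W m) * setprod (~: V i :\: (V m :\: W m)).
    move=> im; rewrite -setprodU; last by rewrite disjoint_sym disjoints_subset setDE subsetIr.
    congr setprod; apply/setP=> c; rewrite !inE.
    case: (boolP (c \in V i)) => ci /=; last by rewrite andbT orbN.
    case: (boolP (c \in V m)) => cm; last by rewrite andbF.
    by rewrite (subsetP (Vm i im)) // inE ci.
  have dV : [disjoint V m :\: W m & ~: V m] by rewrite disjoints_subset setCK subsetDl.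
  apply: (setprod_coprime dV
    (t := - \sum_(i < m) v i * setprod (~: V i :\: (V m :\: W m)))).
  move: E; rewrite big_ord_recr /= addrC => /eqP; rewrite addr_eq0 => /eqP ->.
  rewrite mulrN mulr_sumr; congr (- _); apply: eq_bigr => i _.
  by rewrite (dvd i) // mulrCA.
have [|w Ew] := IHl (fun i => v i - q * relation m i) (ltnW lk).
  have E2 := relation_setprod mk (ltnSn m).
  rewrite big_ord_recr /= relation_diag // in E2.
  have E1 := E; rewrite big_ord_recr /= Eq in E1.
  under eq_bigr do rewrite mulrBl -mulrA.
  rewrite sumrB -mulr_sumr; rewrite (eqP (etrans (esym (addr_eq0 _ _)) (introT eqP E1))).
  rewrite (eqP (etrans (esym (addr_eq0 _ _)) (introT eqP E2))).
  by rewrite mulrN opprK mulrCA mulrA addNr.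
exists (fun j => if j == m then q else w j) => i.
rewrite big_nat_recr //= eqxx ltnS.
rewrite (eq_big_nat _ _ (F2 := fun j => w j * relation j i)); last first.
  by move=> j /andP [_ jm]; rewrite ltn_eqF.
rewrite leq_eqVlt => /orP [/eqP -> | im]; last by rewrite -Ew // subrK.
rewrite relation_diag // Eq big_nat big1 ?add0r 1?mulrC // => j /andP [j0 jm].
by rewrite relation_top ?mulr0 // j0 (ltn_trans jm).
Qed.

(** Descending induction on [j]: at position [j], later relations already have coefficient 0 and
    earlier ones vanish, which leaves [w j] times the diagonal entry. *)
Lemma relation_injective (w : nat -> R) :
  (forall i, (i < k)%N -> \sum_(1 <= j < k) w j * relation j i = 0) ->
  forall j, (0 < j < k)%N -> w j = 0.
Proof.
move=> E j; have [d] := ubnP (k - j); elim: d j => // d IHd j kj jk.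
have [j0 jk'] := andP jk.
have := E j jk'; rewrite (bigD1_seq j) ?iota_uniq ?mem_index_iota //= relation_diag //.
rewrite big_seq_cond big1 ?addr0.
  by move/eqP; rewrite mulf_eq0 (negbTE (setprod_neq0 _)) orbF => /eqP.
move=> i /andP []; rewrite mem_index_iota => ik ij.
have [ji | ij'] := ltnP j i; first by rewrite IHd ?mul0r //; lia.
by rewrite relation_top ?mulr0 //; lia.
Qed.

End TreeSyzygies.

(** * The combinatorics of forests *)

Section Forests.
Variable T : finType.
Implicit Types (D F : {set {set T}}) (Fs : seq {set {set T}}).

Lemma mem_union_complex Fs A : (A \in union_complex Fs) = has (fun F => A \in F) Fs.
Proof.
rewrite /union_complex; elim: Fs => [|F Fs IHs]; first by rewrite big_nil inE.
by rewrite big_cons inE IHs.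
Qed.

(** This recovers the vertex set of a simplex as [cover F], so that vertex sets of a whole list are
    defined without choice. *)
Lemma is_simplex_cover e F : is_simplex e F ->
  F = powerset (cover F) /\ #|cover F|%:Z = e + 1.
Proof.
case=> V [cV ->]; suff -> : cover (powerset V) = V by [].
apply/eqP; rewrite eqEsubset; apply/andP; split.
  by apply/bigcupsP => A; rewrite powersetE.
by apply: (bigcup_max V); rewrite ?powersetE.
Qed.

Lemma fat_forest_head Fs : fat_forest Fs ->
  (0 < size Fs)%N /\ exists e : int, 0 <= e /\ is_simplex e (nth set0 Fs 0).
Proof.
elim=> [F e e0 sF | Fs' F e e' _ [s0 H] _ _ _]; first by split=> //; exists e.
by rewrite size_rcons nth_rcons s0; split.
Qed.

Lemma facets_powerset (V : {set T}) : facets (powerset V) = [set V].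
Proof.
have VV : V \in powerset V by rewrite powersetE.
apply/setP=> A; rewrite inE in_set1; apply/andP/eqP => [[AV /maxsetP [_ maxA]] | ->].
  by apply/esym/maxA => //; rewrite -powersetE.
split=> //; apply/maxsetP; split=> // B; rewrite /= powersetE => BV VB.
by apply/eqP; rewrite eqEsubset BV.
Qed.

(** If [r = d], all simplices of the list coincide, so this case joins that of a single simplex. If
    [r < d], the list enumerates the facets without repetition. *)
Lemma is_forest_cases d r D : is_forest d r D ->
  0 <= d /\
  ((exists V : {set T}, #|V|%:Z = d + 1 /\ D = powerset V) \/
   exists (V W : nat -> {set T}) par, [/\ tree_decomposition #|facets D| V W par, (1 < #|facets D|)%N,
     forall A : {set T}, (exists2 i, (i < #|facets D|)%N & A \subset V i) <-> A \in D
   & [/\ r < d, forall i, (i < #|facets D|)%N -> #|V i|%:Z = d + 1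
       & forall i, (0 < i < #|facets D|)%N -> #|W i|%:Z = r + 1]]).
Proof.
case=> Fs [fatF -> simF simW].
have [s0 [e [e0 sim0]]] := fat_forest_head fatF.
pose V i := cover (nth set0 Fs i).
pose W i := cover (union_complex (take i Fs) :&: nth set0 Fs i).
(* [W i] is itself a face of the union of the simplices before [i], so it lies in one of them;
   [par i] is the first. *)
pose par i := find (fun F => W i \in F) Fs.
have FV i : (i < size Fs)%N -> nth set0 Fs i = powerset (V i).
  by move=> /simF /is_simplex_cover [].
have cV i : (i < size Fs)%N -> #|V i|%:Z = d + 1.
  by move=> /simF /is_simplex_cover [].
have FW i : (0 < i < size Fs)%N ->
    union_complex (take i Fs) :&: nth set0 Fs i = powerset (W i).
  by move=> /simW /is_simplex_cover [].
have cW i : (0 < i < size Fs)%N -> #|W i|%:Z = r + 1.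
  by move=> /simW /is_simplex_cover [].
have d0 : 0 <= d.
  by move: (cV 0%N s0); rewrite (is_simplex_cover sim0).2 => /addIr <-.
split=> //.
have memD (A : {set T}) : reflect (exists2 i, (i < size Fs)%N & A \subset V i) (A \in union_complex Fs).
  rewrite mem_union_complex; apply: (iffP (has_nthP set0)) => [] [i is_ AV]; exists i => //.
    by rewrite -powersetE -FV.
  by rewrite FV // powersetE.
have treeV : tree_decomposition (size Fs) V W par.
  move=> i is_; have [i0 is'] := andP is_.
  have : W i \in powerset (W i) by rewrite powersetE.
  rewrite -FW // inE mem_union_complex FV // powersetE => /andP [/(has_nthP set0) [j]].
  rewrite (size_takel (ltnW is')) => ji; rewrite nth_take // => Wj WV.
  have pj : (par i <= j)%N by rewrite leqNgt; apply/negP => /(before_find set0); rewrite Wj.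
  have pi : (par i < i)%N by apply: leq_ltn_trans ji.
  split=> //.
    rewrite -powersetE -FV; last exact: ltn_trans is'.
    by apply: (@nth_find _ set0 (fun F => W i \in F)); rewrite has_find; apply: ltn_trans is'.
  move=> l li; rewrite -powersetE -FW // inE FV // powersetE subsetIr andbT mem_union_complex.
  apply/(has_nthP set0); exists l; first by rewrite size_takel // ltnW.
  by rewrite nth_take // FV ?powersetE ?subsetIl //; apply: ltn_trans is'.
have [s1 | s1] := leqP (size Fs) 1.
  left; exists (V 0%N); split; first exact: cV.
  apply/setP => A; rewrite powersetE; apply/memD/idP => [[i is_]|AV].
    by have -> : i = 0%N by lia.
  by exists 0%N.
have WV i : (0 < i < size Fs)%N -> (#|W i| <= #|V i|)%N.
  by move=> is_; have [_ WV _ _] := treeV i is_; apply: subset_leq_card.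
have rd : r <= d.
  by have := WV 1%N s1; have := cW 1%N s1; have := cV 1%N s1; lia.
have [/eqP rd' | nrd] := boolP (r == d).
  left; exists (V 0%N); split; first exact: cV.
  have sub0 i : (i < size Fs)%N -> V i \subset V 0%N.
    elim/ltn_ind: i => [[|i]] IHi // is_; have [pi WVi Wp _] := treeV i.+1 is_.
    suff <- : W i.+1 = V i.+1.
      by apply: subset_trans Wp _; apply: IHi => //; apply: ltn_trans is_.
    apply/eqP; rewrite eqEcard WVi /=; have := cW i.+1 is_; have := cV i.+1 is_; lia.
  apply/setP => A; rewrite powersetE; apply/memD/idP => [[i is_]|AV].
    by move/subset_trans; apply; apply: sub0.
  by exists 0%N.
have ltrd : r < d by move/eqP: nrd; lia.
(* Equal cardinals turn an inclusion into an equality, and [V a = V b] with [a < b] would put [V b]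
   inside the smaller set [W b]. *)
have Vinc i j : (i < size Fs)%N -> (j < size Fs)%N -> V i \subset V j -> i = j.
  suff lt a b : (a < b)%N -> (b < size Fs)%N -> V a != V b.
    move=> is_ js VV; have /eqP Vij : V i == V j.
      by rewrite eqEcard VV; have := cV i is_; have := cV j js; lia.
    by case: (ltngtP i j) => // ij; have := lt _ _ ij; rewrite Vij eqxx => /(_ ltac:(by [])).
  move=> ab bs; have b0 : (0 < b < size Fs)%N by lia.
  have [_ _ _ /(_ a ab) Vab] := treeV b b0.
  apply/eqP => E; move: Vab; rewrite E setIid => /subset_leq_card.
  by have := cW b b0; have := cV b bs; lia.
have cardf : #|facets (union_complex Fs)| = size Fs.
  have -> : facets (union_complex Fs) = [set V i | i : 'I_(size Fs)].
    apply/setP=> A; rewrite inE; apply/andP/imsetP => [[AD /maxsetP [_ maxA]] | [i _ ->]].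
      have [i is_ AV] := memD _ AD; exists (Ordinal is_) => //=.
      by apply/esym/maxA => //; apply/memD; exists i.
    have VD : V i \in union_complex Fs by apply/memD; exists i.
    split=> //; apply/maxsetP; split=> // B /memD [j js BV] VB.
    have ij := Vinc i j (ltn_ord i) js (subset_trans VB BV).
    by apply/eqP; rewrite eqEsubset VB andbT ij.
  rewrite card_imset ?card_ord // => i j /= E; apply: val_inj; apply: Vinc (ltn_ord i) (ltn_ord j) _.
  by rewrite E.
right; exists V, W, par; rewrite cardf; split=> // A; exact: rwP (memD A).
Qed.

End Forests.

(** * Vertex counts in a tree decomposition *)

Section TreeCounting.
Variables (T : finType) (k : nat) (V W : nat -> {set T}) (par : nat -> nat) (a e : nat).
Hypothesis treeV : tree_decomposition k V W par.
Hypothesis cV : forall i, (i < k)%N -> #|V i| = a.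
Hypothesis cW : forall i, (0 < i < k)%N -> (#|W i| + e)%N = a.

Lemma card_relation j : (0 < j < k)%N ->
  #|V j :\: W j| = e /\ #|V (par j) :\: W j| = e.
Proof.
move=> jk; have [pj WV Wp _] := treeV jk; have := cW jk.
rewrite !cardsD (setIidPr WV) (setIidPr Wp) !cV ?(ltn_trans pj); lia.
Qed.

(** Each new [V l] meets the union of its predecessors exactly in [W l], so it adds [e] vertices. *)
Lemma card_tree_cover l : (l < k)%N -> #|\bigcup_(i < l.+1) V i| = (a + l * e)%N.
Proof.
elim: l => [|l IHl] lk; first by rewrite big_ord1 cV // mul0n addn0.
have lk' : (0 < l.+1 < k)%N by [].
have [pj WV Wp Vl] := treeV lk'.
rewrite big_ord_recr /= cardsU IHl 1?ltnW //.
have -> : (\bigcup_(i < l.+1) V i) :&: V l.+1 = W l.+1.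
  apply/eqP; rewrite eqEsubset; apply/andP; split.
    apply/subsetP=> c; rewrite inE => /andP [/bigcupP [i _ ci] cl].
    by apply: (subsetP (Vl i (ltn_ord i))); rewrite inE ci.
  rewrite subsetI WV andbT; apply: subset_trans Wp _.
  exact: (bigcup_sup (Ordinal pj)).
have := cW lk'; rewrite cV //; lia.
Qed.

Lemma card_tree : (0 < k)%N -> (forall c, exists2 i, (i < k)%N & c \in V i) ->
  #|T| = (a + k.-1 * e)%N.
Proof.
move=> k0 covV; rewrite -card_tree_cover ?prednK //; apply/eq_card => c.
have [i ik ci] := covV c; symmetry; rewrite inE; apply/bigcupP.
by exists (Ordinal ik).
Qed.

End TreeCounting.

(** * The resolution of the dual of a forest *)

Section Substitution.
Variables (K : fieldType) (n : nat).
Local Notation S := {mpoly K[n]}.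

Definition msubst (f : 'I_n -> S) (p : S) : S := p \mPo [tuple f i | i < n].

HB.instance Definition _ f := GRing.RMorphism.copy (msubst f) (comp_mpoly [tuple f i | i < n]).

Lemma msubstX f i : msubst f 'X_i = f i.
Proof. by rewrite /msubst comp_mpolyXU -tnth_nth tnth_mktuple. Qed.

Lemma msubst_congr (J : S -> Prop) (f : 'I_n -> S) p :
  ideal J -> (forall i, J ('X_i - f i)) -> J (p - msubst f p).
Proof.
move=> idJ Jf; have [J0 JD JM] := idJ.
rewrite /msubst comp_mpolyE {1}[p]mpolyE -sumrB; apply: ideal_sum => // m _.
rewrite -scalerBr -mul_mpolyC; apply: (JM); rewrite mpolyXE_id.
apply: (big_ind2 (fun x y => J (x - y))).
- by rewrite subrr.
- move=> x1 x2 y1 y2 Jx Jy.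
  have -> : x1 * y1 - x2 * y2 = x1 * (y1 - y2) + y2 * (x1 - x2) by ring.
  by apply: JD; apply: JM.
- move=> i _; rewrite tnth_mktuple; elim: (m i) => [|b IHb]; first by rewrite !expr0 subrr.
  rewrite !exprS.
  have -> : 'X_i * 'X_i ^+ b - f i * f i ^+ b =
      'X_i * ('X_i ^+ b - f i ^+ b) + f i ^+ b * ('X_i - f i) by ring.
  by apply: JD; apply: JM.
Qed.

Definition msubst1 (v : 'I_n) (h : S) : S -> S :=
  msubst (fun i => if i == v then h else 'X_i).

HB.instance Definition _ v h := GRing.RMorphism.on (msubst1 v h).

Lemma msubst1X v h i : msubst1 v h 'X_i = if i == v then h else 'X_i.
Proof. exact: msubstX. Qed.

(** A factor theorem: modulo ['X_v - h] every [q] is congruent to its image under the substitution,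
    whatever [h] is. *)
Lemma dvd_msubst1 v h q : msubst1 v h q = 0 -> exists t, q = ('X_v - h) * t.
Proof.
move=> q0; rewrite -[q]subr0 -q0; apply: (@msubst_congr (fun p => exists t, p = ('X_v - h) * t)).
  split; first by exists 0; rewrite mulr0.
  - by move=> x y [s ->] [t ->]; exists (s + t); rewrite mulrDr.
  - by move=> x y [t ->]; exists (x * t); rewrite mulrCA.
move=> i; case: eqP => [->|_]; first by exists 1; rewrite mulr1.
by exists 0; rewrite subrr mulr0.
Qed.

(** If [y c] divides [q * y c'], substituting [h c] for ['X_(v c)] kills [y c] but not [y c']; hence
    it kills [q], and the factor theorem applies. *)
Lemma coprime_msubst1 (T : finType) (y : T -> S) (v : T -> 'I_n) (h : T -> S) :
  (forall c, y c != 0) -> (forall c, y c = 'X_(v c) - h c) ->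
  (forall c, msubst1 (v c) (h c) (y c) = 0) ->
  (forall c c', c != c' -> msubst1 (v c) (h c) (y c') != 0) -> pairwise_coprime y.
Proof.
move=> y0 yE sy0 sy; split=> // c c' q t cc' E.
rewrite yE; apply: dvd_msubst1; have /eqP := congr1 (msubst1 (v c) (h c)) E.
by rewrite !rmorphM /= sy0 mul0r mulf_eq0 (negbTE (sy _ _ cc')) orbF => /eqP.
Qed.

Lemma mpolyXi_neq0 (i : 'I_n) : 'X_i != 0 :> S.
Proof. by rewrite -msupp_eq0 msuppX. Qed.

Lemma coprime_variables : pairwise_coprime (fun i : 'I_n => 'X_i : S).
Proof.
apply: (@coprime_msubst1 _ _ id (fun=> 0)).
- exact: mpolyXi_neq0.
- by move=> c; rewrite subr0.
- by move=> c; rewrite msubst1X eqxx.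
- by move=> c c' cc'; rewrite msubst1X [c' == _]eq_sym (negbTE cc') mpolyXi_neq0.
Qed.

Lemma homogeneous_setprod (A : {set 'I_n}) : homogeneous (setprod (fun i => 'X_i : S) A) #|A|%:Z.
Proof.
rewrite /setprod -big_enum cardE; elim: (enum A) => [|c s IHs].
  by rewrite big_nil; apply: homogeneous1.
rewrite big_cons /= -add1n PoszD; apply: homogeneousM IHs.
by move=> m; rewrite msuppX inE => /eqP ->; rewrite mdeg1.
Qed.

End Substitution.

Section ForestResolution.
Variables (K : fieldType) (n : nat) (D : {set {set 'I_n}}).
Variables (k a e : nat) (V W : nat -> {set 'I_n}) (par : nat -> nat).
Local Notation S := {mpoly K[n]}.
Local Notation X := (fun i : 'I_n => 'X_i : S).
Hypothesis treeV : tree_decomposition k.+1 V W par.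
Hypothesis facesD : forall A : {set 'I_n}, (exists2 i, (i < k.+1)%N & A \subset V i) <-> A \in D.
Hypothesis cV : forall i, (i < k.+1)%N -> #|V i| = a.
Hypothesis cW : forall i, (0 < i < k.+1)%N -> (#|W i| + e)%N = a.
Hypothesis vertices : forall i, [set i] \in D.
Hypothesis k0 : (0 < k)%N.
Hypothesis e0 : (0 < e)%N.
Local Notation I := (SR_ideal K (alexander_dual D)).

Lemma dual_idealP p :
  I p <-> exists v : nat -> S, p = \sum_(i < k.+1) v i * setprod X (~: V i).
Proof.
have idI : ideal I := ideal_genP _.
split=> [|[v ->]]; last first.
  apply: (ideal_sum idI) => i _; have [_ _ IM] := idI; apply: IM.
  apply: ideal_gen_in; exists (~: V i); split=> //.
  by rewrite inE setCK negbK; apply/facesD; exists i.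
apply: (@ideal_gen_sub _ (fun p => exists v : nat -> S, p = \sum_(i < k.+1) v i * setprod X (~: V i))).
  split; first by exists (fun=> 0); rewrite big1 // => i _; rewrite mul0r.
  - move=> x y [v ->] [w ->]; exists (fun i => v i + w i).
    by rewrite -big_split; apply: eq_bigr => i _; rewrite mulrDl.
  - move=> x y [v ->]; exists (fun i => x * v i).
    by rewrite mulr_sumr; apply: eq_bigr => i _; rewrite mulrA.
move=> g [F [/[!inE] /negPn /facesD [i ik FV] ->]].
(* As the complement of [F] lies in [V i], [F] is the disjoint union of [F :&: V i] and [~: V i]. *)
exists (fun j => (j == i)%:R * setprod X (F :&: V i)).
rewrite (bigD1 (Ordinal ik)) //= eqxx mul1r [X in _ + X]big1 ?addr0 => [|j ji]; last first.
  by rewrite -(inj_eq val_inj) /= in ji; rewrite (negbTE ji) !mul0r.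
rewrite -setprodU; last by rewrite disjoints_subset setCK subsetIr.
apply: eq_bigl => c; rewrite !inE.
have := subsetP FV c; rewrite inE.
by case: (c \in F); case: (c \in V i) => //= /(_ isT).
Qed.

Lemma cover_vertices c : exists2 i, (i < k.+1)%N & c \in V i.
Proof. by have [j jk] := (facesD _).2 (vertices c); rewrite sub1set => cj; exists j. Qed.

Lemma card_compl i : (i < k.+1)%N -> #|~: V i| = (k * e)%N.
Proof.
move=> ik; rewrite cardsCs setCK cV // (card_tree treeV cV cW) //= ?addKn //.
exact: cover_vertices.
Qed.

(** The number of facets is [k.+1], so [k] counts the edges of the tree. Relations are attached to
    the positive indices, hence the shift [j.+1] in the second differential. *)
Definition forest_resolution : graded_free K n :=
  @GradedFree K n
    (fun i => match i with 0 => 1 | 1 => k.+1 | 2 => k | _ => 0 end)%N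
    (fun i _ => match i with 0 => 0 | 1 => (k * e)%N%:Z | _ => (k.+1 * e)%N%:Z end)
    (fun i => match i with
     | 0 => \col_(b < k.+1) setprod X (~: V b)
     | 1 => \matrix_(j < k, b < k.+1) relation V W par X j.+1 b
     | _ => 0
     end)
    1%:M.

(** Extension by 0 to all natural numbers, to apply the lemmas on families indexed by [nat] to row
    vectors. *)
Definition coords m (R : nmodType) (v : 'rV[R]_m) (i : nat) : R :=
  if insub i is Some b then v ord0 b else 0.

Lemma coordsE m (R : nmodType) (v : 'rV[R]_m) (b : 'I_m) : coords v b = v ord0 b.
Proof. by rewrite /coords valK. Qed.

Lemma forest_resolutionP : is_resolution I forest_resolution.
Proof.
have idI : ideal I := ideal_genP _.
have cop := @coprime_variables K n.
have sum_rel (w : nat -> S) b : \sum_(1 <= j < k.+1) w j * relation V W par X j b =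
    \sum_(j < k) w j.+1 * relation V W par X j.+1 b.
  by rewrite big_add1 big_mkord.
split.
- split; last first.
    by move=> a'; rewrite mxE ord1 /=; apply: homogeneous1.
  case=> [|[|i]] a' b /=; last by case: a'.
    by rewrite mxE subr0 -(card_compl (ltn_ord a')); apply: homogeneous_setprod.
  have jk : (0 < a'.+1 < k.+1)%N by rewrite /= ltnS.
  have [cu cw] := card_relation treeV cV cW jk.
  have -> : (k.+1 * e)%N%:Z - (k * e)%N%:Z = e%:Z by rewrite mulSn PoszD addrK.
  rewrite mxE; apply: homogeneousB.
    rewrite -[in X in homogeneous _ X]cu -[X in homogeneous _ X]add0r.
    apply: (homogeneousM (e := 0)); last exact: homogeneous_setprod.
    by case: eqP => _; [apply: homogeneous1 | apply: homogeneous0].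
  rewrite -[in X in homogeneous _ X]cw -[X in homogeneous _ X]add0r.
  apply: (homogeneousM (e := 0)); last exact: homogeneous_setprod.
  by case: eqP => _; [apply: homogeneous1 | apply: homogeneous0].
- move=> p; exists (const_mx p); rewrite mulmx1 mxE subrr.
  by case: idI.
- move=> v; rewrite mulmx1; split=> [/dual_idealP [w Ew] | [w ->]].
    exists (\row_b w b); apply/rowP => b; rewrite ord1 Ew mxE.
    by apply: eq_bigr => i _; rewrite !mxE.
  apply/dual_idealP; exists (coords w); rewrite mxE.
  by apply: eq_bigr => i _; rewrite coordsE mxE.
- case=> [|[|i]] v /=; last by
    split=> _; [exists 0; rewrite [LHS]thinmx0 [RHS]thinmx0 | rewrite mulmx0].
  (* Exactness at F_1: the relations generate the syzygies of the generators. *)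
  + split=> [v0 | [w ->]].
      have [|w Ew] := syzygy_relations treeV cop (v := coords v) (leqnn k.+1).
        have := congr1 (fun M : 'M_1 => M ord0 ord0) v0; rewrite !mxE => E; rewrite -[RHS]E.
        by apply: eq_bigr => i _; rewrite coordsE mxE.
      exists (\row_j w j.+1); apply/rowP => b; rewrite -coordsE Ew // sum_rel mxE.
      by apply: eq_bigr => j _; rewrite !mxE.
    rewrite -mulmxA; have -> : (\matrix_(j < k, b < k.+1) relation V W par X j.+1 b) *m
        (\col_(b < k.+1) setprod X (~: V b)) = 0; last by rewrite mulmx0.
    apply/colP => j; have jk : (0 < j.+1 < k.+1)%N by rewrite /= ltnS.
    rewrite !mxE -[RHS](relation_setprod X treeV jk (l := k.+1)) //.
    by apply: eq_bigr => b _; rewrite !mxE.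
  (* Exactness at F_2: the relations are independent and F_3 is zero. *)
  + split=> [v0 | [w ->]]; last by rewrite mulmx0 mul0mx.
    exists 0; rewrite mul0mx; apply/rowP => j; rewrite mxE -coordsE.
    apply: (relation_injective (w := fun j => coords v j.-1) treeV cop _ (j := j.+1)) => [b bk|]; last first.
      by rewrite /= ltnS.
    rewrite sum_rel; have := congr1 (fun M : 'rV_k.+1 => M ord0 (Ordinal bk)) v0.
    by rewrite !mxE => E; rewrite -[RHS]E; apply: eq_bigr => i _; rewrite coordsE mxE.
Qed.

Lemma setprod_constant0 (A : {set 'I_n}) : (0 < #|A|)%N -> (setprod X A)@_0%MM = 0.
Proof.
move=> A0; apply/eqP/negPn/negP => /((homogeneousP _ _).1 (@homogeneous_setprod K n A)).
by rewrite mdeg0 => -[E]; rewrite -E in A0.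
Qed.

(** The entries have positive degree [k * e] or [e], so their constant terms vanish. *)
Lemma forest_resolution_minimal i : diffK forest_resolution i = 0.
Proof.
apply/matrixP => a' b; rewrite mxE [RHS]mxE; case: i a' b => [|[|i]] a' b /=.
- by rewrite mxE setprod_constant0 // card_compl // muln_gt0 k0.
- have jk : (0 < a'.+1 < k.+1)%N by rewrite /= ltnS.
  have [cu cw] := card_relation treeV cV cW jk.
  rewrite mxE mcoeffB !(rmorphM (mcoeff 0%MM : {rmorphism S -> K})) /=.
  by rewrite !setprod_constant0 ?cu ?cw // !mulr0 subrr.
- by rewrite mxE mcoeff0.
Qed.

Lemma forest_homology_dim i j : homology_dim forest_resolution i j =
  if j == match i with 0 => 0 | 1 => (k * e)%N%:Z | _ => (k.+1 * e)%N%:Z end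
  then gf_rank forest_resolution i else 0%N.
Proof.
rewrite /homology_dim forest_resolution_minimal mulmx0 mxrank0 subn0.
have -> : (\rank (cycles forest_resolution i :&: degree_part forest_resolution i j)%MS =
    \rank (degree_part forest_resolution i j))%N.
  case: i => [|i] /=; first by rewrite cap1mx.
  by rewrite forest_resolution_minimal (cap_eqmx (kermx0 _ _ _) (eqmx_refl _)) cap1mx.
rewrite /degree_part /= eq_sym; case: eqP => _ /=.
  rewrite (_ : \row__ _ = const_mx 1); last by apply/rowP => b; rewrite !mxE.
  by rewrite diag_const_mx mxrank1.
rewrite (_ : \row__ _ = 0); last by apply/rowP => b; rewrite !mxE.
by rewrite raddf0 mxrank0.
Qed.

End ForestResolution.

(** * Dimension and depth bounds *)

Section Dimension.
Variables (K : fieldType) (n : nat).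
Local Notation S := {mpoly K[n]}.

(* Reading exponents off the base-[N] digits of [a] indexes the monomials by an
   initial segment of [nat]. *)
Fixpoint digit_monomial (N l : nat) (y : nat -> S) (a : nat) : S :=
  if l is l'.+1 then
    y 0%N ^+ (a %% N) * digit_monomial N l' (fun i => y i.+1) (a %/ N)
  else 1.

(** Sort the polynomial by powers of [y 0]. If [e] is the least exponent not yet treated, [y 0 ^+ e]
    cancels by regularity; modulo [J 1] only [R e] remains, and induction on [l] makes its
    coefficients vanish. *)
Lemma chain_independent N l (J : nat -> S -> Prop) (y : nat -> S) (q : nat -> K) :
  (0 < N)%N ->
  (forall i, (i <= l)%N -> ideal (J i)) ->
  (forall i x, (i < l)%N -> J i x -> J i.+1 x) ->
  (forall i, (i < l)%N -> J i.+1 (y i)) ->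
  (forall i g, (i < l)%N -> J i (g * y i) -> J i g) ->
  ~ J l 1 ->
  J 0%N (\sum_(0 <= a < N ^ l) (q a)%:MP * digit_monomial N l y a) ->
  forall a, (a < N ^ l)%N -> q a = 0.
Proof.
move=> N0; elim: l J y q => [|l IHl] J y q idJ subJ Jy regJ J1.
  rewrite expn0 big_nat1 mulr1 => Jq [|//] _; apply/eqP/negPn/negP => q0; apply: J1.
  have [_ _ JM] := idJ 0%N isT; have := JM (q 0%N)^-1%:MP _ Jq.
  by rewrite -mpolyCM mulVf.
pose R e := \sum_(0 <= b < N ^ l) (q (b * N + e)%N)%:MP * digit_monomial N l (fun i => y i.+1) b.
have -> : \sum_(0 <= a < N ^ l.+1) (q a)%:MP * digit_monomial N l.+1 y a =
    \sum_(0 <= e < N) y 0%N ^+ e * R e.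
  rewrite expnSr big_nat_mul.
  under [RHS]eq_bigr do rewrite mulr_sumr.
  rewrite [RHS]exchange_big /=; apply: eq_bigr => b _.
  rewrite -{1}[(b * N)%N]add0n mulSn big_addn addnK !big_nat; apply: eq_bigr => e /andP [_ eN].
  rewrite addnC divnMDl // divn_small // addn0 modnMDl modn_small //.
  by rewrite mulrCA.
move=> JR.
have [J0 JD JM] := idJ 0%N isT; have [J10 J1D J1M] := idJ 1%N isT.
suff H e : (e < N)%N -> forall b, (b < N ^ l)%N -> q (b * N + e)%N = 0.
  move=> a aN; rewrite (divn_eq a N); apply: H; first by rewrite ltn_mod.
  by rewrite ltn_divLR // -expnSr.
elim/ltn_ind: e => e IHe eN.
apply: (IHl (fun i => J i.+1) (fun i => y i.+1) (fun b => q (b * N + e)%N)) => //.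
- by move=> i il; apply: idJ.
- by move=> i x il; apply: subJ.
- by move=> i il; apply: Jy.
- by move=> i g il; apply: regJ.
rewrite -/(R e).
pose U := \sum_(e.+1 <= e' < N) y 0%N ^+ (e' - e.+1) * R e'.
have {}JR : J 0%N ((R e + y 0%N * U) * y 0%N ^+ e).
  have := JR; rewrite (big_cat_nat (n := e)) ?(ltnW eN) //= big_nat big1 ?add0r.
    rewrite big_ltn //; congr J; rewrite mulrDl mulrC; congr (_ + _).
    rewrite /U mulr_sumr mulr_suml !big_nat; apply: eq_bigr => e' /andP [ee' _].
    have -> : y 0%N ^+ e' = y 0%N ^+ e * (y 0%N * y 0%N ^+ (e' - e.+1)).
      by rewrite -exprS -exprD; congr (_ ^+ _); lia.
    by ring.
  move=> e' /andP [_ e'e]; rewrite /R big_nat big1 ?mulr0 // => b /andP [_ bl].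
  by rewrite (IHe e' e'e (ltn_trans e'e eN) b bl) raddf0 mul0r.
have reg_exp b x : J 0%N (x * y 0%N ^+ b) -> J 0%N x.
  elim: b x => [|b IHb] x; first by rewrite expr0 mulr1.
  by rewrite exprSr mulrA => /regJ -/(_ isT) /IHb.
move/reg_exp: JR => /(subJ _ _ (ltn0Sn l)) J1R; rewrite -[R e](addrK (y 0%N * U)).
by apply: idealB => //; rewrite mulrC; apply: J1M; apply: Jy.
Qed.

Definition msupport (m : 'X_{1..n}) : {set 'I_n} := [set i | m i != 0%N].

(** Every monomial is a multiple of the squarefree monomial of its support. *)
Lemma SR_ideal_msupp (G : {set {set 'I_n}}) (p : S) :
  (forall m, m \in msupp p -> msupport m \notin G) -> SR_ideal K G p.
Proof.
have idG : ideal (SR_ideal K G) := ideal_genP _.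
move=> Gp; rewrite [p]mpolyE; apply: ideal_sum_seq => // m mp.
have [_ _ IM] := idG.
have -> : p@_m *: 'X_[m] = (p@_m *: \prod_i 'X_i ^+ (m i).-1) * \prod_(i in msupport m) 'X_i.
  rewrite -scalerAl; congr (_ *: _); rewrite mpolyXE_id [X in _ * X]big_mkcond -big_split /=.
  apply: eq_bigr => i _; rewrite inE; case: (m i) => [|b]; first by rewrite expr0 mulr1.
  by rewrite exprSr.
by apply: IM; apply: ideal_gen_in; exists (msupport m); split=> //; apply: Gp.
Qed.

Definition degree_le (p : S) (b : nat) : Prop := forall m, m \in msupp p -> (mdeg m <= b)%N.

Lemma degree_leM p q b c : degree_le p b -> degree_le q c -> degree_le (p * q) (b + c).
Proof.
move=> pb qc m /msuppM_le /allpairsP [[m1 m2] /= [/pb m1b /qc m2c ->]].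
by rewrite mdegD leq_add.
Qed.

Lemma degree_le1 b : degree_le 1 b.
Proof. by move=> m; rewrite msupp1 inE => /eqP ->; rewrite mdeg0. Qed.

Lemma degree_le_leq p b c : (b <= c)%N -> degree_le p b -> degree_le p c.
Proof. by move=> bc pb m /pb /leq_trans; apply. Qed.

Lemma degree_leX p b e : degree_le p b -> degree_le (p ^+ e) (e * b).
Proof.
move=> pb; elim: e => [|e IHe]; first exact: degree_le1.
by rewrite exprS mulSn; apply: degree_leM.
Qed.

Lemma degree_le_digit N l y a b : (0 < N)%N ->
  (forall i, (i < l)%N -> degree_le (y i) b) ->
  degree_le (digit_monomial N l y a) (l * (N * b)).
Proof.
move=> N0; elim: l y a => [|l IHl] y a yb /=; first exact: degree_le1.
rewrite mulSn; apply: degree_leM; last by apply: IHl => i il; apply: yb.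
apply: (@degree_le_leq _ (a %% N * b)); first by rewrite leq_mul2r ltnW ?orbT // ltn_mod.
by apply: degree_leX; apply: yb.
Qed.

Lemma degree_le_exists l (y : nat -> S) : exists b, forall i, (i < l)%N -> degree_le (y i) b.
Proof.
exists (\max_(i < l) msize (y i)) => i il m mp; apply: ltnW.
apply: leq_trans (mmeasure_mnm_lt mdeg mp) _.
exact: (@leq_bigmax _ (fun i : 'I_l => msize (y i)) (Ordinal il)).
Qed.

(** There are at most [2 ^ n] supports in [G], each with at most [D] free exponents: the count grows
    like [M ^ D]. *)
Lemma card_standard (G : {set {set 'I_n}}) M D :
  (forall F, F \in G -> (#|F| <= D)%N) ->
  (#|[set m : {ffun 'I_n -> 'I_M.+1} | [set i | m i != ord0] \in G]| <= 2 ^ n * M.+1 ^ D)%N.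
Proof.
move=> GD.
apply: (@leq_trans #|\bigcup_(F in G) [set m in pffun_on (ord0 : 'I_M.+1) F predT]|).
  apply/subset_leq_card/subsetP => m; rewrite inE => mG; apply/bigcupP.
  exists [set i | m i != ord0] => //; rewrite inE; apply/pffun_onP; split=> //.
  by apply/subsetP => i; rewrite !inE.
apply: (@leq_trans (\sum_(F in G) M.+1 ^ D)).
  elim/big_ind2: _ => [|A a B b Aa Bb|F FG]; first by rewrite cards0.
    by rewrite (leq_trans (leq_card_setU _ _)) ?leq_add.
  have -> : #|[set m in pffun_on (ord0 : 'I_M.+1) F predT]| = (M.+1 ^ #|F|)%N.
    by rewrite cardsE card_pffun_on card_ord.
  by rewrite leq_pexp2l ?GD.
rewrite sum_nat_const leq_mul2r; apply/orP; right.
have := card_powerset [set: 'I_n]; rewrite cardsT card_ord => <-.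
by apply/subset_leq_card/subsetP => F _; rewrite powersetE subsetT.
Qed.

(** There are [N ^ D.+1] monomials in the [y i], while standard monomials up to their degree number
    only of the order of [N ^ D]; for large [N] linear algebra yields a relation modulo the
    ideal. *)
Lemma algebraic_dependence (G : {set {set 'I_n}}) D (y : nat -> S) :
  (forall F, F \in G -> (#|F| <= D)%N) ->
  exists N (q : nat -> K), [/\ (0 < N)%N, exists2 a, (a < N ^ D.+1)%N & q a != 0
    & SR_ideal K G (\sum_(0 <= a < N ^ D.+1) (q a)%:MP * digit_monomial N D.+1 y a)].
Proof.
move=> GD; have [b yb] := degree_le_exists D.+1 y.
(* [M] bounds the degrees of the products, and [M.+1 <= N * (D.+1 * b).+1]; so [N] exceeds the
   constant factor left after extracting [N ^ D]. *)
pose N := (2 ^ n * (D.+1 * b).+1 ^ D).+1; pose M := (D.+1 * (N * b))%N.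
pose A := [set m : {ffun 'I_n -> 'I_M.+1} | [set i | m i != ord0] \in G].
have cA : (#|A| < N ^ D.+1)%N.
  apply: leq_ltn_trans (card_standard M GD) _.
  apply: (@leq_ltn_trans (2 ^ n * (N * (D.+1 * b).+1) ^ D)%N).
    have mono x z : (x <= z)%N -> (x ^ D <= z ^ D)%N.
      by move=> xz; case: (posnP D) => [->|D0]; rewrite ?expn0 ?leq_exp2r.
    rewrite leq_mul2l mono ?orbT // /M mulnCA mulnS.
    by rewrite -add1n leq_add2r.
  by rewrite expnMn mulnCA expnSr ltn_mul2l expn_gt0 ltnSn.
pose mon (c : 'I_#|A|) : 'X_{1..n} := [multinom (enum_val c i : nat) | i < n].
pose X : 'M[K]_(N ^ D.+1, #|A|) := \matrix_(a, c) (digit_monomial N D.+1 y a)@_(mon c).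
pose w := nz_row (kermx X).
have w0 : w != 0.
  by rewrite nz_row_eq0 -mxrank_eq0 mxrank_ker subn_eq0 -ltnNge (leq_ltn_trans (rank_leq_col X)).
have wX : w *m X = 0 by apply/sub_kermxP/nz_row_sub.
exists N, (coords w); split=> //.
  have /rV0Pn [a wa] := w0; exists a => //; by rewrite coordsE.
apply: SR_ideal_msupp => m.
rewrite mcoeff_msupp; apply: contra => mG; rewrite big_mkord.
have degm a : m \in msupp (digit_monomial N D.+1 y a) -> (mdeg m <= M)%N.
  exact: degree_le_digit.
rewrite linear_sum /=.
have [mM | Mm] := leqP (mdeg m) M; last first.
  rewrite big1 // => a _; rewrite mcoeffCM memN_msupp_eq0 ?mulr0 //.
  by apply/negP => /degm; rewrite leqNgt Mm.
have mi i : (m i < M.+1)%N.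
  by rewrite ltnS (leq_trans _ mM) // mdegE (bigD1 i) //= leq_addr.
pose f : {ffun 'I_n -> 'I_M.+1} := [ffun i => Ordinal (mi i)].
have fA : f \in A.
  rewrite inE; suff -> : [set i | f i != ord0] = msupport m by [].
  by apply/setP=> i; rewrite !inE ffunE -(inj_eq val_inj).
have /matrixP /(_ ord0 (enum_rank_in fA f)) := wX; rewrite !mxE => E.
rewrite -[X in _ == X]E; apply/eqP; apply: eq_bigr => a _.
rewrite mcoeffCM coordsE mxE; congr (_ * _@__).
by apply/mnmP => i; rewrite mnmE enum_rankK_in // ffunE.
Qed.

(** Common to chains of primes, where [y i] lies in the next prime but not in the current one, and
    to regular sequences. *)
Lemma dimension_bound (G : {set {set 'I_n}}) D l (J : nat -> S -> Prop) (y : nat -> S) :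
  (forall F, F \in G -> (#|F| <= D)%N) ->
  (forall i, (i <= l)%N -> ideal (J i)) ->
  (forall p, SR_ideal K G p -> J 0%N p) ->
  (forall i x, (i < l)%N -> J i x -> J i.+1 x) ->
  (forall i, (i < l)%N -> J i.+1 (y i)) ->
  (forall i g, (i < l)%N -> J i (g * y i) -> J i g) ->
  ~ J l 1 -> (l <= D)%N.
Proof.
move=> GD idJ IJ subJ Jy regJ J1; rewrite leqNgt; apply/negP => Dl.
have [N [q [N0 [a aN qa] Iq]]] := algebraic_dependence y GD.
case/eqP: qa; apply: (chain_independent N0 _ _ _ _ _ (IJ _ Iq)) aN.
- by move=> i iD; apply: idJ; apply: leq_trans Dl.
- by move=> i x iD; apply: subJ; apply: leq_trans Dl.
- by move=> i iD; apply: Jy; apply: leq_trans Dl.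
- by move=> i g iD; apply: regJ; apply: leq_trans Dl.
- move=> JD1; apply: J1.
  suff H i : (D.+1 + i <= l)%N -> J (D.+1 + i)%N 1 by rewrite -(subnKC Dl); apply: H; rewrite subnKC.
  elim: i => [|i IHi]; first by rewrite addn0.
  by rewrite addnS => il; apply: subJ => //; apply: IHi; apply: ltnW.
Qed.

End Dimension.

(** * Chains of primes generated by variables, and the two upper bounds *)

Section VariablePrimes.
Variables (K : fieldType) (n : nat).
Local Notation S := {mpoly K[n]}.

(** The kernel is the ideal of the variables in [A]; its primality is inherited from the domain
    [S]. *)
Definition kill (A : {set 'I_n}) : S -> S := msubst (fun i => if i \in A then 0 else 'X_i).

HB.instance Definition _ A := GRing.RMorphism.on (kill A).

Lemma killX A i : kill A 'X_i = if i \in A then 0 else 'X_i.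
Proof. exact: msubstX. Qed.

Lemma prime_kill A : prime_ideal (fun p => kill A p = 0).
Proof.
split; first split.
- by rewrite rmorph0.
- by move=> x y x0 y0; rewrite rmorphD /= x0 y0 addr0.
- by move=> x y y0; rewrite rmorphM /= y0 mulr0.
- by rewrite rmorph1 => /eqP; rewrite oner_eq0.
- by move=> x y /eqP; rewrite rmorphM mulf_eq0 => /orP [] /eqP; [left | right].
Qed.

Lemma kill_subset (A B : {set 'I_n}) p : A \subset B -> kill A p = 0 -> kill B p = 0.
Proof.
move=> AB pA; rewrite -[p]subr0 -[X in _ - X]pA.
apply: (msubst_congr (J := fun p => kill B p = 0)).
  by case: (prime_kill B).
move=> i; rewrite rmorphB /=; case: ifP => iA; last by rewrite subrr.
by rewrite killX (subsetP AB) // rmorph0 subrr.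
Qed.

(** Every nonface contains [a] or [b], so the ideal lies in the prime of these two variables;
    adjoining the other variables one by one gives [n - 2] strict steps. *)
Lemma krull_chain (G : {set {set 'I_n}}) (a b : 'I_n) : a != b ->
  (forall F, F \notin G -> (a \in F) || (b \in F)) ->
  exists c, prime_chain (SR_ideal K G) c (n - 2).
Proof.
move=> ab Gab.
have [u [uu su au bu]] : exists u : seq 'I_n, [/\ uniq u, size u = n,
    forall i, a \in take i.+2 u & forall i, b \in take i.+2 u].
  pose u := [:: a; b] ++ [seq x <- enum 'I_n | x \notin [:: a; b]]; exists u.
  have uu : uniq u.
    rewrite cat_uniq filter_uniq ?enum_uniq // andbT /= inE ab /=.
    by apply/hasPn => x; rewrite mem_filter => /andP [].
  have pu : perm_eq u (enum 'I_n).
    apply: uniq_perm; rewrite ?enum_uniq // => x; rewrite mem_enum mem_cat mem_filter mem_enum.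
    by case: (x \in [:: a; b]).
  by split=> [||i|i]; rewrite ?(perm_size pu) ?size_enum_ord // !inE eqxx ?orbT.
pose A i : {set 'I_n} := [set x in take i.+2 u].
exists (fun i p => kill (A i) p = 0); split=> [i _|i il].
  split; first exact: prime_kill.
  apply: ideal_gen_sub; first by case: (prime_kill (A i)).
  move=> g [F [/Gab abF ->]].
  have [x xA xF] : exists2 x, x \in A i & x \in F.
    by case/orP: abF => xF; [exists a | exists b]; rewrite // inE.
  by rewrite rmorph_prod (bigD1 x) //= killX xA mul0r.
have iu : (i.+2 < size u)%N by rewrite su; lia.
split=> [x|].
  apply: kill_subset; apply/subsetP => y; rewrite !inE.
  by rewrite (take_nth a iu) mem_rcons inE => ->; rewrite orbT.
exists 'X_(nth a u i.+2); split; rewrite killX inE.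
  by rewrite (take_nth a iu) mem_rcons mem_head.
rewrite (_ : _ \in _ = false); first by move/eqP; rewrite (negbTE (mpolyXi_neq0 _ _)).
by apply/negbTE; rewrite in_take ?mem_nth // index_uniq // ltnn.
Qed.

Lemma krull_bound (G : {set {set 'I_n}}) D c l :
  (forall F, F \in G -> (#|F| <= D)%N) -> prime_chain (SR_ideal K G) c l -> (l <= D)%N.
Proof.
move=> GD [pc sc].
pose y i := epsilon (inhabits (0 : S)) (fun x => c i.+1 x /\ ~ c i x).
have yP i : (i < l)%N -> c i.+1 (y i) /\ ~ c i (y i).
  by move=> /sc [_ ex]; apply: epsilon_spec ex.
apply: (dimension_bound (J := c) (y := y) GD).
- by move=> i /pc [[]].
- by move=> p; apply: (pc 0%N isT).2.
- by move=> i x /sc [sub _]; apply: sub.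
- by move=> i /yP [].
- move=> i g il; have [[_ _ pr] _] := pc i (ltnW il); move/pr => [//|].
  by have [_ ] := yP i il.
- by have [[_ c1 _] _] := pc l (leqnn l).
Qed.

Lemma depth_bound (G : {set {set 'I_n}}) D s :
  (forall F, F \in G -> (#|F| <= D)%N) ->
  regular_sequence (SR_ideal K G) s -> (size s <= D)%N.
Proof.
move=> GD [reg s1].
apply: (dimension_bound (J := fun i => ideal_add (SR_ideal K G) (take i s))
  (y := nth 0 s) GD).
- by move=> i _; apply: ideal_genP.
- by move=> p Ip; apply: ideal_gen_in; left.
- move=> i x is_; apply: ideal_gen_sub; first exact: ideal_genP.
  move=> g [Ig | gs]; apply: ideal_gen_in; [by left | right].
  by rewrite (take_nth 0) // mem_rcons inE gs orbT.
- move=> i is_; apply: ideal_gen_in; right.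
  by rewrite (take_nth 0) // mem_rcons mem_head.
- by move=> i g is_; apply: reg.
- by rewrite take_size.
Qed.

End VariablePrimes.

(** * A regular sequence *)

Section SystemOfParameters.
Variables (K : fieldType) (n : nat).
Local Notation S := {mpoly K[n.+2]}.
Local Notation x0 := ('X_(inord 0) : S).
Local Notation x1 := ('X_(inord 1) : S).

(** Powers of [x1] give enough pairwise coprime elements over every field, finite ones included. *)
Definition curve (b : nat) : S := x0 + x1 ^+ b.

(* The images of the variables modulo the first [j] elements of [parameters]. *)
Definition stage (j : nat) (c : 'I_n.+2) : S :=
  if (2 <= c < j.+2)%N then curve c else 'X_c.

Definition parameter (j : nat) : S := 'X_(inord j.+2) - curve j.+2.

Definition parameters : seq S := mkseq parameter n.

Lemma ord_eq_inord (c : 'I_n.+2) b : (b < n.+2)%N -> (c == inord b) = (c == b :> nat).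
Proof. by move=> bn; rewrite -(inj_eq val_inj) /= inordK. Qed.

Lemma curve_neq0 b : (0 < b)%N -> curve b != 0.
Proof.
move=> b0; apply/negP => /eqP /(congr1 (meval (fun i : 'I_n.+2 => (i == inord 0)%:R))).
rewrite rmorphD rmorphXn /= !mevalXU meval0 eqxx (ord_eq_inord _ (ltn0Sn _)) inordK //.
by rewrite expr0n gtn_eqF // addr0 => /eqP; rewrite oner_eq0.
Qed.

(** Each member is linear in one variable, [x0] for a curve and ['X_c] otherwise. Eliminating [x0]
    by one curve turns another into a difference of distinct powers of [x1]. *)
Lemma pairwise_coprime_stage j : pairwise_coprime (stage j).
Proof.
pose elim (c : 'I_n.+2) := (2 <= c < j.+2)%N.
pose v c : 'I_n.+2 := if elim c then inord 0 else c.
pose h (c : 'I_n.+2) : S := if elim c then - x1 ^+ c else 0.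
have n0 : (0 < n.+2)%N by [].
have n1 : (1 < n.+2)%N by [].
have x01 : inord 1 == inord 0 :> 'I_n.+2 = false by rewrite (ord_eq_inord _ n0) inordK.
have sX0 c : elim c -> msubst1 (v c) (h c) x0 = - x1 ^+ c.
  by move=> ec; rewrite msubst1X /v /h ec eqxx.
have sX1 c : elim c -> msubst1 (v c) (h c) x1 = x1.
  by move=> ec; rewrite msubst1X /v ec x01.
apply: (@coprime_msubst1 _ _ _ _ v h).
- move=> c; rewrite /stage; case: ifP => [/andP [c2 _]|_]; last exact: mpolyXi_neq0.
  by apply: curve_neq0; apply: ltnW.
- move=> c; rewrite /stage -/(elim c) /v /h; case: ifP => _; last by rewrite subr0.
  by rewrite opprK.
- move=> c; rewrite /stage -/(elim c); case: ifP => ec; last first.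
    by rewrite msubst1X /v /h ec eqxx.
  by rewrite rmorphD rmorphXn /= sX0 // sX1 // addNr.
- move=> c c' cc'; rewrite /stage -/(elim c'); case: (boolP (elim c)) => ec.
    case: ifP => ec'.
      rewrite rmorphD rmorphXn /= sX0 // sX1 // addrC subr_eq0.
      apply/eqP => /(congr1 (mcoeff (U_(inord 1) *+ c))).
      rewrite !mpolyXn !mcoeffX eqxx.
      case: eqP => [E _ | _ /eqP]; last by rewrite eq_sym oner_eq0.
      have := congr1 mdeg E; rewrite !mdegMn !mdeg1 !mul1n => /val_inj E'.
      by rewrite E' eqxx in cc'.
    rewrite msubst1X /v /h ec; case: ifP => _; last exact: mpolyXi_neq0.
    by rewrite oppr_eq0 expf_neq0 // mpolyXi_neq0.
  rewrite /v /h (negbTE ec); case: ifP => ec'; last first.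
    by rewrite msubst1X [c' == _]eq_sym (negbTE cc') mpolyXi_neq0.
  have c'2 : (2 <= c')%N by case/andP: ec'.
  rewrite rmorphD rmorphXn /= !msubst1X.
  (* Setting the variable ['X_c] to 0 turns the curve into [x1 ^+ c'] for index 0, into [x0] for
     index 1, and leaves it unchanged otherwise. *)
  have [E0 | c0] := eqVneq (inord 0) c.
    rewrite add0r expf_neq0 // -E0 x01; exact: mpolyXi_neq0.
  have [E1 | c1] := eqVneq (inord 1) c; last by apply: curve_neq0; apply: ltnW.
  by rewrite expr0n gtn_eqF ?addr0 ?mpolyXi_neq0 // ltnW.
Qed.

Lemma parameter_neq0 j : (j < n)%N -> parameter j != 0.
Proof.
move=> jn; apply/negP => /eqP /(congr1 (meval (fun i : 'I_n.+2 => (i == inord j.+2)%:R))).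
rewrite rmorphB /= /curve rmorphD rmorphXn /= !mevalXU meval0 eqxx !ord_eq_inord // !inordK //.
by rewrite expr0n /= addr0 subr0 => /eqP; rewrite oner_eq0.
Qed.

Lemma msubst_stage_parameter j t : (t < n)%N ->
  msubst (stage j) (parameter t) = if (t < j)%N then 0 else parameter t.
Proof.
move=> tn; rewrite /parameter /curve rmorphB rmorphD rmorphXn /= !msubstX /stage.
by rewrite !inordK //=; case: (ltnP t j) => tj; case: ifP; rewrite ?subrr //; lia.
Qed.

Lemma parameter_ideal (j : nat) (I : S -> Prop) c : (j <= n)%N ->
  ideal_add I (take j parameters) ('X_c - stage j c).
Proof.
move=> jn; rewrite /stage; case: ifP => [/andP [c2 cj] | _]; last first.
  by rewrite subrr; case: (ideal_genP (fun p => I p \/ p \in take j parameters)).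
apply: ideal_gen_in; right.
have E : 'X_c - curve c = parameter (c - 2).
  by rewrite /parameter (_ : (c - 2).+2 = c) ?inord_val //; lia.
rewrite E -(nth_mkseq 0 parameter (n := n)); last by lia.
have cj2 : (c - 2 < j)%N by lia.
rewrite -(nth_take 0 cj2) mem_nth // size_takel // size_mkseq //.
Qed.

End SystemOfParameters.

Lemma msubst_setprod (K : fieldType) n (f : 'I_n -> {mpoly K[n]}) (A : {set 'I_n}) :
  msubst f (setprod (fun i => 'X_i) A) = setprod f A.
Proof. by rewrite rmorph_prod; apply: eq_bigr => i _; rewrite /= msubstX. Qed.

(** * Cohen-Macaulayness of the dual of a forest *)

Section ForestDepth.
Variables (K : fieldType) (n : nat) (D : {set {set 'I_n.+2}}).
Variables (k a e : nat) (V W : nat -> {set 'I_n.+2}) (par : nat -> nat).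
Local Notation S := {mpoly K[n.+2]}.
Local Notation X := (fun i : 'I_n.+2 => 'X_i : S).
Hypothesis treeV : tree_decomposition k.+1 V W par.
Hypothesis facesD : forall A : {set 'I_n.+2}, (exists2 i, (i < k.+1)%N & A \subset V i) <-> A \in D.
Hypothesis cV : forall i, (i < k.+1)%N -> #|V i| = a.
Hypothesis cW : forall i, (0 < i < k.+1)%N -> (#|W i| + e)%N = a.
Hypothesis vertices : forall i, [set i] \in D.
Hypothesis k0 : (0 < k)%N.
Hypothesis e0 : (0 < e)%N.
Local Notation I := (SR_ideal K (alexander_dual D)).

(** The substitution [stage K j] kills the first [j] parameters and is the identity modulo them, so
    the quotient can be tested on images. *)
Lemma stage_idealP j p : (j <= n)%N ->
  ideal_add I (take j (parameters K n)) p <->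
  exists v : nat -> S, msubst (stage K j) p = \sum_(i < k.+1) v i * setprod (stage K j) (~: V i).
Proof.
move=> jn.
pose Q := ideal_add I (take j (parameters K n)).
have idQ : ideal Q := ideal_genP _.
have congrQ q : Q (q - msubst (stage K j) q).
  by apply: msubst_congr => // c; apply: parameter_ideal.
split=> [|[v Ev]]; last first.
  apply/(idealBr idQ (congrQ p)); rewrite Ev.
  apply: (ideal_sum idQ) => i _; have [_ _ QM] := idQ; apply: (QM).
  rewrite -msubst_setprod; apply: (iffLR (idealBr idQ (congrQ (setprod X (~: V i))))).
  apply: ideal_gen_in; left; apply/(dual_idealP facesD).
  exists (fun b : nat => (b == i)%:R); rewrite (bigD1 i) //= eqxx mul1r big1 ?addr0 // => b.
  by rewrite -(inj_eq val_inj) /= => /negbTE ->; rewrite mul0r.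
apply: (@ideal_gen_sub _ (fun p => exists v : nat -> S,
  msubst (stage K j) p = \sum_(i < k.+1) v i * setprod (stage K j) (~: V i))).
  split.
  - by exists (fun=> 0); rewrite rmorph0 big1 // => i _; rewrite mul0r.
  - move=> x y [v Ex] [w Ey]; exists (fun i => v i + w i).
    by rewrite rmorphD /= Ex Ey -big_split; apply: eq_bigr => i _; rewrite mulrDl.
  - move=> x y [v Ey]; exists (fun i => msubst (stage K j) x * v i).
    by rewrite rmorphM /= Ey mulr_sumr; apply: eq_bigr => i _; rewrite mulrA.
move=> g [/(dual_idealP facesD) [v ->] | /(nthP 0) [t]].
  exists (fun i => msubst (stage K j) (v i)); rewrite rmorph_sum; apply: eq_bigr => i _.
  by rewrite rmorphM /= msubst_setprod.
rewrite size_takel ?size_mkseq // => tj; rewrite nth_take // nth_mkseq ?(leq_trans tj) // => <-.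
exists (fun=> 0); rewrite (msubst_stage_parameter _ _ (leq_trans tj jn)) tj.
by rewrite big1 // => i _; rewrite mul0r.
Qed.

(** Modulo [x] the coefficients [v] become a syzygy of the next stage, hence a combination of
    relations. These lift to the current stage and contribute 0, so [v] may be taken divisible by
    [x], which is then cancelled. *)
Lemma regular_parameters j g : (j < n)%N ->
  ideal_add I (take j (parameters K n)) (g * parameter K n j) ->
  ideal_add I (take j (parameters K n)) g.
Proof.
move=> jn; set x := parameter K n j.
move/(stage_idealP _ (ltnW jn)) => [v Ev]; apply/(stage_idealP _ (ltnW jn)).
rewrite rmorphM /= msubst_stage_parameter // ltnn -/x in Ev.
pose sigma : {rmorphism S -> S} := msubst1 (inord j.+2 : 'I_n.+2) (curve K n j.+2).
pose multx p := exists t, p = x * t.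
have idx : ideal multx.
  split; first by exists 0; rewrite mulr0.
  - by move=> q q' [s ->] [t ->]; exists (s + t); rewrite mulrDr.
  - by move=> q q' [t ->]; exists (q * t); rewrite mulrCA.
have jn2 : (j.+2 < n.+2)%N by [].
have sigmaX c : sigma 'X_c = if c == inord j.+2 then curve K n j.+2 else 'X_c.
  exact: msubst1X.
have congrx q : multx (q - sigma q).
  apply: msubst_congr => // c; case: eqP => [->|_]; first by exists 1; rewrite mulr1.
  by exists 0; rewrite subrr mulr0.
have sigma_curve b : sigma (curve K n b) = curve K n b.
  by rewrite /curve rmorphD rmorphXn /= !sigmaX !ord_eq_inord // !inordK.
have sigma_stage c : sigma (stage K j c) = stage K j.+1 c.
  rewrite /stage; case: ifP => cj.
    by rewrite sigma_curve ifT //; lia.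
  rewrite sigmaX ord_eq_inord //; case: eqP => [-> | cj2].
    by rewrite ifT //; lia.
  by rewrite ifF //; lia.
have sigma_setprod A : sigma (setprod (stage K j) A) = setprod (stage K j.+1) A.
  by rewrite rmorph_prod; apply: eq_bigr => c _; apply: sigma_stage.
have sigma_rel l i : sigma (relation V W par (stage K j) l i) = relation V W par (stage K j.+1) l i.
  by rewrite /relation rmorphB !rmorphM /= !sigma_setprod !rmorph_nat.
have sx : sigma x = 0.
  by rewrite /x /parameter rmorphB /= sigmaX eqxx sigma_curve subrr.
have [|w Ew] := syzygy_relations treeV (pairwise_coprime_stage K n j.+1)
    (v := fun i => sigma (v i)) (leqnn k.+1).
  have := congr1 sigma Ev; rewrite rmorphM /= sx mulr0 rmorph_sum => E.
  by rewrite [RHS]E; apply: eq_bigr => i _; rewrite rmorphM /= sigma_setprod.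
(* [v i] and the relations are congruent to their images modulo [x]; [sigma] is not applied to the
   coefficients [w l]. *)
have /fin_all_exists [t Et] (i : 'I_k.+1) :
    multx (v i - \sum_(1 <= l < k.+1) w l * relation V W par (stage K j) l i).
  have -> : v i - \sum_(1 <= l < k.+1) w l * relation V W par (stage K j) l i =
      (v i - sigma (v i)) - \sum_(1 <= l < k.+1) w l *
        (relation V W par (stage K j) l i - sigma (relation V W par (stage K j) l i)).
    under [X in _ = _ - X]eq_bigr do rewrite sigma_rel mulrBr.
    by rewrite Ew // sumrB opprB addrA subrK.
  apply: idealB => //; apply: ideal_sum => // l _.
  by have [_ _ xM] := idx; apply: xM.
exists (fun i => oapp t 0 (insub i)).
apply: (mulIf (parameter_neq0 K jn)); rewrite -/x Ev mulr_suml.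
have -> : \sum_(i < k.+1) v i * setprod (stage K j) (~: V i) =
    \sum_(i < k.+1) x * t i * setprod (stage K j) (~: V i) +
    \sum_(1 <= l < k.+1) w l * \sum_(i < k.+1) relation V W par (stage K j) l i * setprod (stage K j) (~: V i).
  under [X in _ + X]eq_bigr do rewrite mulr_sumr.
  rewrite exchange_big -big_split /=; apply: eq_bigr => i _; rewrite -Et mulrBl mulr_suml.
  by under [X in _ + X]eq_bigr do rewrite mulrA; rewrite subrK.
rewrite [X in _ + X]big_nat [X in _ + X]big1 ?addr0 => [|l lk]; last first.
  by rewrite (relation_setprod _ treeV lk) ?mulr0 //; case/andP: lk.
by apply: eq_bigr => i _; rewrite valK /=; ring.
Qed.

Lemma constant_coeff0 p : I p -> p@_0%MM = 0.
Proof.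
move/(dual_idealP facesD) => [v ->]; rewrite raddf_sum big1 //= => i _.
rewrite (rmorphM (mcoeff 0%MM : {rmorphism S -> K})) /=.
rewrite setprod_constant0 ?mulr0 // (card_compl treeV facesD cV cW) // muln_gt0 k0.
exact: e0.
Qed.

Lemma parameter_constant0 j : (j < n)%N -> (parameter K n j)@_0%MM = 0.
Proof.
move=> jn; have X0 c : ('X_c : S)@_0%MM = 0 by rewrite mcoeffX mnm1_eq0.
rewrite /parameter /curve mcoeffB mcoeffD !X0 exprS.
by rewrite (rmorphM (mcoeff 0%MM : {rmorphism S -> K})) /= X0 mul0r addr0 subr0.
Qed.

Lemma parameter_irrelevant j : irrelevant_ideal (parameter K n j).
Proof.
have idm : ideal (@irrelevant_ideal K n.+2) := ideal_genP _.
have mX c : irrelevant_ideal ('X_c : S) by apply: ideal_gen_in; exists c.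
apply: idealB => //; have [_ mD mM] := idm; apply: mD => //.
by rewrite exprSr; apply: mM.
Qed.

Lemma parameters_regular : regular_sequence I (parameters K n).
Proof.
split=> [j|].
  by rewrite size_mkseq => jn g; rewrite nth_mkseq //; apply: regular_parameters.
have id0 : ideal (fun p : S => p@_0%MM = 0).
  split=> [|x y x0 y0|x y y0]; first by rewrite mcoeff0.
    by rewrite mcoeffD x0 y0 addr0.
  by rewrite (rmorphM (mcoeff 0%MM : {rmorphism S -> K})) /= y0 mulr0.
move/(ideal_gen_sub id0) => H.
suff : (1 : S)@_0%MM = 0 by rewrite mcoeff1 eqxx => /eqP; rewrite oner_eq0.
apply: H => g [/constant_coeff0 // | /(nthP 0) [t]].
by rewrite size_mkseq => tn <-; rewrite nth_mkseq // parameter_constant0.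
Qed.

(** The complement of a face of the dual is a nonface of [D], so it has at least two elements. *)
Lemma card_dual_face F : F \in alexander_dual D -> (#|F| <= n)%N.
Proof.
rewrite inE => FD; have := cardsC F; rewrite card_ord.
suff : (1 < #|~: F|)%N by lia.
rewrite ltnNge; apply/negP => F1; case/negP: FD.
have [F0 | /card_gt0P [c cF]] := posnP #|~: F|.
  by rewrite (cards0_eq F0); apply/facesD; exists 0%N; rewrite ?sub0set.
suff -> : ~: F = [set c] by [].
by apply/esym/eqP; rewrite eqEcard sub1set cF cards1.
Qed.

(** Take one vertex of [V k] and one of [V (par k)], both outside [W k]. The first lies in no other
    [V i], the second not in [V k], so no face of [D] contains both. *)
Lemma exists_nonedge : exists a b, a != b /\
  forall F, F \notin alexander_dual D -> (a \in F) || (b \in F).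
Proof.
have kk : (0 < k < k.+1)%N by rewrite k0 /=.
have [pk WV Wp Vk] := treeV kk.
have [c1 c2] := card_relation treeV cV cW kk.
have /card_gt0P [a1] : (0 < #|V k :\: W k|)%N by rewrite c1.
have /card_gt0P [b1] : (0 < #|V (par k) :\: W k|)%N by rewrite c2.
rewrite !inE => /andP [bW bV] /andP [aW aV].
exists a1, b1; split.
  apply/eqP => E; case/negP: aW; apply: (subsetP (Vk _ pk)).
  by rewrite inE aV andbT E.
move=> F; rewrite inE negbK => /facesD [i ik FV]; apply/negPn/negP.
rewrite negb_or => /andP [aF bF].
have /(subsetP FV) aVi : a1 \in ~: F by rewrite inE.
have /(subsetP FV) bVi : b1 \in ~: F by rewrite inE.
move: ik; rewrite ltnS leq_eqVlt => /orP [/eqP ik | ik].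
  by case/negP: bW; apply: (subsetP (Vk _ pk)); rewrite inE bV -ik.
by case/negP: aW; apply: (subsetP (Vk _ ik)); rewrite inE aVi aV.
Qed.

Lemma forest_cohen_macaulay : cohen_macaulay I.
Proof.
right; exists n; split; split.
- have [a1 [b1 [ab GF]]] := exists_nonedge.
  by have := krull_chain K ab GF; rewrite (_ : (n.+2 - 2 = n)%N) //; lia.
- by move=> c l; apply: krull_bound => F; apply: card_dual_face.
- exists (parameters K n); split; last by rewrite size_mkseq.
    exact: parameters_regular.
  move=> p /(nthP 0) [t]; rewrite size_mkseq => tn <-; rewrite nth_mkseq //.
  exact: parameter_irrelevant.
- move=> s reg _; apply: depth_bound reg => F; apply: card_dual_face.
Qed.

End ForestDepth.

(** * Betti numbers *)

Lemma ideal_gen_hcomp (K : fieldType) n (G : {mpoly K[n]} -> Prop) p e :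
  (forall g, G g -> exists e', homogeneous g e') -> ideal_gen G p -> ideal_gen G (hcomp e p).
Proof.
move=> homG [s [Gs ->]]; rewrite hcomp_sum; apply: ideal_sum_seq; first exact: ideal_genP.
move=> u us; have [e' hu] := homG _ (Gs u us).
rewrite -[e](subrK e') hcompM //; have [_ _ GM] := ideal_genP G.
by apply: GM; apply: ideal_gen_in; apply: Gs.
Qed.

Lemma SR_ideal_hcomp (K : fieldType) n (G : {set {set 'I_n}}) p e :
  SR_ideal K G p -> SR_ideal K G (hcomp e p).
Proof.
apply: ideal_gen_hcomp => g [F [_ ->]]; exists #|F|%:Z; exact: homogeneous_setprod.
Qed.

Lemma homology_dim_eq0 (K : fieldType) n (C : graded_free K n) i j :
  (forall b : 'I_(gf_rank C i), gf_deg b != j) -> homology_dim C i j = 0%N.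
Proof.
move=> degj; have D0 : degree_part C i j = 0.
  apply/matrixP=> b b'; rewrite !mxE (negbTE (degj b)); exact: mul0rn.
by rewrite /homology_dim D0 capmx0 mxrank0.
Qed.

(** The chosen resolution may be nonminimal: further degrees in its list contribute 0, and if [g] is
    missing from the list then [b] is 0. *)
Lemma total_betti_concentrated (K : fieldType) n (I : {mpoly K[n]} -> Prop) i (g : int) b :
  (forall j, betti I i j = if j == g then b else 0%N) -> total_betti I i = b.
Proof.
move=> bI; rewrite /total_betti; set s := [seq _ | _ : _].
rewrite (eq_bigr _ (fun j _ => bI j)) -big_mkcond /= -big_filter.
have [gs | gs] := boolP (g \in s).
  rewrite (perm_big [:: g]) ?big_seq1 //; apply: uniq_perm => [||j] //.
    by rewrite filter_uniq ?undup_uniq.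
  by rewrite mem_filter mem_undup inE; case: eqP => [->|].
rewrite (_ : [seq _ <- _ | _] = [::]) ?big_nil.
  have := bI g; rewrite eqxx => <-; rewrite /betti homology_dim_eq0 // => c.
  by apply: contraNneq gs => <-; apply: map_f; rewrite mem_enum.
apply/eqP; rewrite -[_ == _]negbK -has_filter; apply/hasPn => j.
by rewrite mem_undup => js; apply: contraNneq gs => <-.
Qed.

(** * The unit ideal, which arises from a single simplex *)

Section UnitIdeal.
Variables (K : fieldType) (n : nat) (I : {mpoly K[n]} -> Prop).
Hypothesis I_all : forall p, I p.

Lemma betti_unit_ideal i j : betti I i j = 0%N.
Proof.
have idI : ideal I by split.
rewrite (@betti_resolution _ _ _ idI _ (zero_graded_free K n)) //; last first.
  split=> //.
  - by split=> [i'|] [].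
  - by move=> p; exists 0.
  - by move=> v; split=> // _; exists 0; rewrite [LHS]thinmx0 [RHS]thinmx0.
  - by move=> i' v; split=> _; [exists 0|]; rewrite [LHS]thinmx0 [RHS]thinmx0.
by apply: homology_dim_eq0 => -[].
Qed.

Lemma linear_resolution_unit_ideal : linear_resolution I.
Proof.
exists 0%N; split; last by move=> i j _ _; apply: betti_unit_ideal.
exists (fun g => g = 1); split; first by move=> g ->; apply: dhomog1.
move=> p; split=> // _; rewrite -[p]mulr1.
by have [_ _ gM] := ideal_genP (fun g : {mpoly K[n]} => g = 1); apply: gM; apply: ideal_gen_in.
Qed.

End UnitIdeal.

(** * Betti numbers and linearity for at least two facets *)

Section ForestBetti.
Variables (K : fieldType) (n : nat) (D : {set {set 'I_n}}).
Variables (k a e : nat) (V W : nat -> {set 'I_n}) (par : nat -> nat).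
Local Notation S := {mpoly K[n]}.
Hypothesis treeV : tree_decomposition k.+1 V W par.
Hypothesis facesD : forall A : {set 'I_n}, (exists2 i, (i < k.+1)%N & A \subset V i) <-> A \in D.
Hypothesis cV : forall i, (i < k.+1)%N -> #|V i| = a.
Hypothesis cW : forall i, (0 < i < k.+1)%N -> (#|W i| + e)%N = a.
Hypothesis vertices : forall i, [set i] \in D.
Hypothesis k0 : (0 < k)%N.
Hypothesis e0 : (0 < e)%N.
Local Notation I := (SR_ideal K (alexander_dual D)).

Lemma forest_betti i j : betti I i j =
  if j == match i with 0 => 0 | 1 => (k * e)%N%:Z | _ => (k.+1 * e)%N%:Z end
  then match i with 0 => 1 | 1 => k.+1 | 2 => k | _ => 0 end else 0%N.
Proof.
have resC := forest_resolutionP K treeV facesD cV cW vertices.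
rewrite (betti_resolution (ideal_genP _) (@SR_ideal_hcomp _ _ _) _ _ resC).
exact: (forest_homology_dim K treeV facesD cV cW vertices).
Qed.

Lemma forest_linear_resolution : linear_resolution I <-> e = 1%N.
Proof.
split=> [[t [_ lin]] | e1].
  (* Nonzero Betti numbers in homological degrees 1 and 2 give [k * e = t] and [k.+1 * e = t + 1],
     whence [e = 1]. *)
  have b1 : (k * e)%N%:Z = 1%:Z + t%:Z - 1.
    apply/eqP/negPn/negP => /eqP /(lin 1%N _ isT).
    by rewrite forest_betti eqxx.
  have b2 : (k.+1 * e)%N%:Z = 2%:Z + t%:Z - 1.
    apply/eqP/negPn/negP => /eqP /(lin 2%N _ isT).
    by rewrite forest_betti eqxx; lia.
  by lia.
exists k; split; last first.
  move=> [|[|[|i]]] j //; rewrite forest_betti e1 !muln1; case: eqP => // ->; lia.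
exists (fun g => exists2 i, (i < k.+1)%N & g = setprod (fun i => 'X_i) (~: V i)); split.
  move=> g [i ik ->]; apply/dhomogP => m /homogeneous_setprod [dm].
  by apply: etrans dm _; rewrite (card_compl treeV facesD cV cW) // e1 muln1.
move=> p; split.
  move/(dual_idealP facesD) => [v ->]; apply: (ideal_sum (ideal_genP _)) => i _.
  set G := fun g => _; have [_ _ GM] := ideal_genP G; apply: GM.
  by apply: ideal_gen_in; exists i.
apply: ideal_gen_sub; first exact: ideal_genP.
move=> g [i ik ->]; apply: ideal_gen_in; exists (~: V i); split=> //.
by rewrite inE setCK negbK; apply/facesD; exists i.
Qed.

End ForestBetti.

(** Passes from integer dimensions to the cardinals [a = d + 1] and [e = d - r], positive once there
    are two facets. *)
Lemma forest_nat_data (T : finType) (D : {set {set T}}) d r k :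
  is_forest d r D -> #|facets D| = k.+1 -> (0 < k)%N ->
  exists a e V W par,
    [/\ tree_decomposition k.+1 V W par,
        forall A : {set T}, (exists2 i, (i < k.+1)%N & A \subset V i) <-> A \in D,
        forall i, (i < k.+1)%N -> #|V i| = a,
        forall i, (0 < i < k.+1)%N -> (#|W i| + e)%N = a
      & [/\ (0 < a)%N, (0 < e)%N & d - r = e%:Z]].
Proof.
move=> /is_forest_cases [d0 [[V [_ ->]] | [V [W [par [treeV k1 DV [rd cV cW]]]]]]] fk k0.
  by rewrite facets_powerset cards1 in fk; case: fk k0 => <-.
exists (absz (d + 1)), (absz (d - r)), V, W, par; rewrite -fk; split=> //.
- by move=> i /cV; lia.
- by move=> i /cW; lia.
- by split; lia.
Qed.

Theorem theorem7 (K : fieldType) (n : nat) (Delta : {set {set 'I_n}})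
    (d r : int) (k : nat)
    (vertices : forall i : 'I_n, [set i] \in Delta)
    (forest : is_forest d r Delta)
    (nfacets : #|facets Delta| = k) :
  let I := SR_ideal K (alexander_dual Delta) in
  let b := betti I in
  [/\ (2 <= k)%N ->
        [/\ total_betti I 0 = 1%N /\ b 0%N 0 = 1%N,
            total_betti I 1 = k /\ b 1%N ((k%:Z - 1) * (d - r)) = k,
            total_betti I 2 = (k - 1)%N /\ b 2%N (k%:Z * (d - r)) = (k - 1)%N
          & forall (i : nat) (j : int), b i j <> 0%N ->
              (i, j) \in [:: (0%N, 0 : int); (1%N, (k%:Z - 1) * (d - r));
                             (2%N, k%:Z * (d - r))]],
      cohen_macaulay I
    & linear_resolution I <-> is_forest d (d - 1) Delta].
Proof.
move=> I b; have [d0 cases] := is_forest_cases forest.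
have [k1 | k1] := leqP k 1.
  have {cases} [V [cV DV]] : exists V : {set 'I_n}, #|V|%:Z = d + 1 /\ Delta = powerset V.
    case: cases => // -[V [W [par [_]]]]; rewrite nfacets ltnNge k1; by [].
  (* All vertices lie in the one simplex, so the dual has no faces and the empty monomial 1 is a
     generator. *)
  have I_all p : I p.
    have [_ _ IM] : ideal I := ideal_genP _.
    rewrite -[p]mulr1; apply: IM; apply: ideal_gen_in; exists set0; rewrite big_set0; split=> //.
    rewrite inE negbK DV setC0 powersetE; apply/subsetP => i _.
    by have := vertices i; rewrite DV powersetE sub1set.
  split; [by [] | by left | split=> _].
    have sV : is_simplex d Delta by exists V.
    exists [:: Delta]; split; first exact: FatForest1 d0 sV.
    - by rewrite /union_complex big_seq1.
    - by case.
    - by case=> [|i].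
  exact: linear_resolution_unit_ideal.
case: k nfacets k1 {cases} => [|k] // nfacets; rewrite ltnS => k0.
have [a [e [V [W [par [treeV DV cV cW [a0 e0 Ee]]]]]]] := forest_nat_data forest nfacets k0.
have bE := forest_betti K treeV DV cV cW vertices k0 e0.
have D1 : (k.+1%:Z - 1) * (d - r) = (k * e)%N by rewrite Ee; lia.
have D2 : k.+1%:Z * (d - r) = (k.+1 * e)%N by rewrite Ee PoszM.
split.
- move=> _; rewrite D1 D2 subn1 /=; split.
  + by rewrite /b /I bE; split=> //; apply: total_betti_concentrated => j; rewrite bE.
  + by rewrite /b /I bE eqxx; split=> //; apply: total_betti_concentrated => j; rewrite bE.
  + by rewrite /b /I bE eqxx; split=> //; apply: total_betti_concentrated => j; rewrite bE.
  + move=> i j; rewrite /b /I bE; case: eqP => // -> nz.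
    by case: i nz => [|[|[|i]]] //; rewrite !inE !eqxx ?orbT.
(* [n = a + k * e] with all three positive, so the variables [x0] and [x1] exist. *)
- have : (1 < n)%N.
    have := card_tree treeV cV cW isT (cover_vertices DV vertices).
    by rewrite card_ord => ->; rewrite (leq_add a0) // muln_gt0 k0.
  rewrite /I; move: vertices {forest I b bE nfacets} V W treeV DV cV cW; case: n Delta => [|[|n]] //.
  move=> Delta vertices V W treeV DV cV cW _.
  exact: (forest_cohen_macaulay K treeV DV cV cW vertices k0 e0).
split=> [/(forest_linear_resolution K treeV DV cV cW vertices k0 e0) e1 | forest1].
  by rewrite (_ : d - 1 = r) //; lia.
(* The same complex presented as a forest with [r = d - 1] has its own decomposition, with [e' = 1],
   to which the criterion applies. *)
have [a' [e' [V' [W' [par' [treeV' DV' cV' cW' [_ e0' Ee']]]]]]] := forest_nat_data forest1 nfacets k0.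
apply/(forest_linear_resolution K treeV' DV' cV' cW' vertices k0 e0'); lia.
Qed.
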